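(* Let $A$, $B$, $C$ be SMLC $*$-algebras and let $f:A\times[0,\infty)\to B$ and $g:B\times[0,\infty)\to C$ be pointwise bounded asymptotic morphisms (PBAMs). If $f$ and $g$ satisfy the following two conditions C1 and C3, then there is a continuous increasing function $\phi:[0,\infty)\to[0,\infty)$ which is a valid reparameterisation for $f$ and $g$. C1: For all $a\in A$ and all $\nu>0$ there are $\xi>0$ and $Q'\ge0$ such that for all $t\ge Q'$ there is $S'\ge0$ such that for all $b\in B$ and $s\ge S'$: $d(f_t(a),b)<\xi$ implies $d(g_s(f_t(a)),g_s(b))<\nu$. C3: For all $a\in A$ and all $n\in\mathbb N$ there are $Q_n\ge0$ and $M_n\ge0$ such that for all $t\ge Q_n$ there is $S_n\ge0$ such that for all $s\ge S_n$: $|g_s(f_t(a))|_n\le M_n$.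
   Context: An SMLC $*$-algebra is a separable metrisable locally convex complex $*$-algebra with continuous multiplication and $*$-operation. Its topology is given by seminorms $|\cdot|_0,|\cdot|_1,\dots$ and by a translation invariant metric $d$; the seminorms are chosen so that $|b|_n\le|b|_{n+1}$, $|b^*|_n\le|b|_{n+1}$ and $|bb'|_n\le|b|_{n+1}|b'|_{n+1}$. No unit is assumed. PBAM: a continuous function $f:A\times[0,\infty)\to B$, $(a,t)\mapsto f_t(a)$, such that (a) for all $a\in A$ and $n\in\mathbb N$ the set $\{|f_t(a)|_n:t\ge0\}$ is bounded; (b) $f$ is strongly asymptotically continuous: for all $\epsilon>0$ and $a\in A$ there are $\eta>0$ and $P\ge0$ such that for all $a'\in A$ with $d(a,a')<\eta$ and all $t\ge P$, $d(f_t(a),f_t(a'))<\epsilon$; and, as $t\to\infty$, for all $a,a'\in A$, $\lambda\in\mathbb C$: (c) $f_t(a)^*-f_t(a^* )\to0$; (d) $\lambda f_t(a)-f_t(\lambda a)\to0$; (e) $f_t(a)+f_t(a')-f_t(a+a')\to0$; (f) $f_t(a)f_t(a')-f_t(aa')\to0$. PBA homotopy: two PBAMs $k,l:A\times[0,\infty)\to C$ are PBA homotopic if there is a PBAM $h:A\times[0,\infty)\to C([0,1],C)$ with $h_t(a)(0)=k_t(a)$ and $h_t(a)(1)=l_t(a)$, where $C([0,1],C)$ is the algebra of continuous functions $[0,1]\to C$ with pointwise operations and the supremum metric. Composition: for a continuous increasing $\phi:[0,\infty)\to[0,\infty)$ define $g\circ_\phi f:A\times[0,\infty)\to C$ by $(g\circ_\phi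 f)_t(a)=g_{\phi(t)}(f_t(a))$. The function $\phi$ is a valid reparameterisation for $f$ and $g$ if (a) $g\circ_\phi f$ is a PBAM, and (b) for every continuous increasing $\theta:[0,\infty)\to[0,\infty)$ with $\theta(t)\ge\phi(t)$ for all $t$, $g\circ_\theta f$ is also a PBAM and is PBA homotopic to $g\circ_\phi f$ via the PBAM $h:A\times[0,\infty)\to C([0,1],C)$ given by $h_t(a)(p)=g_{p\phi(t)+(1-p)\theta(t)}(f_t(a))$. *)

(* Defs.v *)
From HB Require Import structures.
Set Warnings "-notation-overridden,-ambiguous-paths,-notation-incompatible-prefix,-redundant-canonical-projection".
From mathcomp Require Import all_boot all_order all_algebra.
From mathcomp Require Import complex.
From mathcomp Require Import all_classical all_reals all_analysis.
From mathcomp Require Import ring lra.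

Set Implicit Arguments.
Unset Strict Implicit.
Unset Printing Implicit Defensive.

Import Order.TTheory GRing.Theory Num.Theory.
Import numFieldTopology.Exports numFieldNormedType.Exports.
Import ComplexField.Normc.

Local Open Scope classical_set_scope.
Local Open Scope ring_scope.

(* MathComp rings are unital, so the product is part of this interface. As the
   seminorms increase with [n], balls for a single seminorm form a
   neighbourhood base, which is what [seminorm_nbhsE] says. Continuity of the
   product and of the star follows from the inequalities relating consecutive
   seminorms. The metric is a component of this record, and not a [metricType]
   instance, because the hierarchy has no join of metric spaces with modules. *)
HB.mixin Record isSeminormedStarAlgebra (R : realType) B
    & PreTopologicalLmodule R[i] B := {
  amul : B -> B -> B ;
  astar : B -> B ;
  seminorm : nat -> B -> R ;
  dist : B -> B -> R ;
  amulA : forall x y z, amul x (amul y z) = amul (amul x y) z ;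
  amulDl : forall x y z, amul (x + y) z = amul x z + amul y z ;
  amulDr : forall x y z, amul x (y + z) = amul x y + amul x z ;
  amulZl : forall (k : R[i]) x y, amul (k *: x) y = k *: amul x y ;
  amulZr : forall (k : R[i]) x y, amul x (k *: y) = k *: amul x y ;
  astarK : forall x, astar (astar x) = x ;
  astarD : forall x y, astar (x + y) = astar x + astar y ;
  astarZ : forall (k : R[i]) x, astar (k *: x) = conjc k *: astar x ;
  astarM : forall x y, astar (amul x y) = amul (astar y) (astar x) ;
  seminormD : forall n x y, seminorm n (x + y) <= seminorm n x + seminorm n y ;
  seminormZ : forall n (k : R[i]) x,
    seminorm n (k *: x) = normc k * seminorm n x ;
  seminorm_leS : forall n x, seminorm n x <= seminorm n.+1 x ;
  seminorm_star : forall n x, seminorm n (astar x) <= seminorm n.+1 x ;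
  seminorm_mul : forall n x y,
    seminorm n (amul x y) <= seminorm n.+1 x * seminorm n.+1 y ;
  seminorm_nbhsE : forall (x : B) (U : set B),
    nbhs x U <->
    exists n (e : R), 0 < e /\ forall y, seminorm n (y - x) < e -> U y ;
  dist_eq0 : forall x y, dist x y = 0 <-> x = y ;
  dist_sym : forall x y, dist x y = dist y x ;
  dist_triangle : forall y x z, dist x z <= dist x y + dist y z ;
  dist_translation : forall z x y, dist (x + z) (y + z) = dist x y ;
  dist_nbhsE : forall (x : B) (U : set B),
    nbhs x U <-> exists e : R, 0 < e /\ forall y, dist x y < e -> U y
}.

#[short(type="seminormedStarAlgType")]
HB.structure Definition SeminormedStarAlgebra (R : realType) :=
  {B of PreTopologicalLmodule R[i] B & isSeminormedStarAlgebra R B}.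

HB.mixin Record isSeparable B & Topological B := {
  separable : exists2 D : set B, countable D & dense D
}.

#[short(type="smlcStarAlgType")]
HB.structure Definition SMLCStarAlgebra (R : realType) :=
  {B of SeminormedStarAlgebra R B & Tvs R[i] B & isSeparable B}.

Section seminormed_theory.
Context {R : realType} {B : seminormedStarAlgType R}.
Implicit Types (x y z : B) (n : nat).
Local Open Scope convex_scope.

Lemma seminorm0 n : seminorm n (0 : B) = 0.
Proof. by rewrite -(scale0r (0 : B)) seminormZ normc0 mul0r. Qed.

Lemma seminormN n x : seminorm n (- x) = seminorm n x.
Proof. by rewrite -scaleN1r seminormZ normcN normc1 mul1r. Qed.

Lemma seminorm_ge0 n x : 0 <= seminorm n x.
Proof.
have := seminormD n x (- x); rewrite subrr seminorm0 seminormN.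
by rewrite -mulr2n pmulrn_lge0.
Qed.

Lemma seminormB n x y : seminorm n (x - y) = seminorm n (y - x).
Proof. by rewrite -seminormN opprB. Qed.

Lemma seminorm_triangle n y x z :
  seminorm n (x - z) <= seminorm n (x - y) + seminorm n (y - z).
Proof. by rewrite -[x - z](subrKA y); exact: seminormD. Qed.

Lemma seminorm_le m n x : (m <= n)%N -> seminorm m x <= seminorm n x.
Proof.
move=> mn; rewrite -(subnK mn); elim: (n - m)%N => // k IH.
by rewrite addSn (le_trans IH)// seminorm_leS.
Qed.

Lemma nbhs_seminorm n x (e : R) : 0 < e ->
  nbhs x [set y | seminorm n (y - x) < e].
Proof. by move=> e0; apply/seminorm_nbhsE; exists n, e. Qed.

Lemma dist_sub x y : dist x y = dist 0 (y - x).
Proof. by rewrite -(dist_translation (- x)) subrr. Qed.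

Lemma cvg_seminormP T (F : set_system T) (FF : Filter F) (f : T -> B) x :
  f @ F --> x <-> forall n e, 0 < e -> \near F, seminorm n (f F - x) < e.
Proof.
split=> [fx n e e0|fx U]; first exact: (fx _ (nbhs_seminorm n x e0)).
move=> /seminorm_nbhsE[n [e [e0 eU]]].
by rewrite /nbhs/=; near do apply: eU; exact: fx.
Unshelve. all: by end_near. Qed.

Lemma smlc_add_continuous : continuous (fun x : B * B => x.1 + x.2).
Proof.
move=> [x y]; apply/cvg_seminormP => n e e0.
have e20 : 0 < e / 2 by rewrite divr_gt0.
exists ([set z | seminorm n (z - x) < e / 2],
        [set z | seminorm n (z - y) < e / 2]).
  by split; exact: nbhs_seminorm.
move=> [u v] /= [xu yv]; rewrite opprD addrACA.
by rewrite (le_lt_trans (seminormD _ _ _))// [ltRHS]splitr ltrD.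
Qed.

Lemma smlc_scale_continuous :
  continuous (fun z : (R[i])^o * B => z.1 *: z.2).
Proof.
move=> [k x]; apply/cvg_seminormP => n e e0.
pose c := 1 + normc k + seminorm n x.
have nk : 0 <= normc k by case: (k) => a b; exact: sqrtr_ge0.
have c0 : 0 < c by rewrite /c -addrA ltr_wpDr// addr_ge0// seminorm_ge0.
pose d := Num.min 1 (e / 2 / c).
have d0 : 0 < d by rewrite lt_min ltr01 !divr_gt0.
have dC0 : 0 < (d%:C)%C :> R[i] by rewrite ltcR.
exists (ball (k : (R[i])^o) (d%:C)%C, [set z | seminorm n (z - x) < d]).
  by split; [exact: nbhsx_ballx|exact: nbhs_seminorm].
move=> [l y] /= []; rewrite -ball_normE /= => kl xy.
have {}kl : normc (l - k) < d.
  by rewrite -ltcR -normcN opprB.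
rewrite -[l *: y - _](subrKA (l *: x)) -scalerBr -scalerBl.
rewrite (le_lt_trans (seminormD _ _ _))// !seminormZ.
have l1 : normc l <= 1 + normc k.
  rewrite -[l](subrK k) (le_trans (le_normcD _ _))// lerD2r ltW//.
  by rewrite (lt_le_trans kl)// /d ge_min lexx.
have dc : d * c <= e / 2.
  by rewrite -ler_pdivlMr// /d ge_min lexx orbT.
have ? := seminorm_ge0 n x; have ? := seminorm_ge0 n (y - x).
have h1 : normc l * seminorm n (y - x) <= (1 + normc k) * d.
  by apply: ler_pM => //; [case: (l) => a b; exact: sqrtr_ge0|exact: ltW].
have h2 : normc (l - k) * seminorm n x <= d * seminorm n x.
  by apply: ler_wpM2r => //; exact: ltW.
have : (1 + normc k) * d + d * seminorm n x = d * c.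
  by rewrite /c mulrDr [d * (_ + _)]mulrC.
lra.
Qed.

Lemma smlc_ball_convex n x (e : R) :
  convex_set [set y : B | seminorm n (y - x) < e].
Proof.
apply/convex_setW => y z /[!inE]/= xy xz l l0 l1; rewrite inE/=.
pose r := complex.Re (l%:num : R[i]).
have lr : (l%:num : R[i]) = (r%:C)%C by apply/esym/RRe_real/gtr0_real.
have r0 : 0 < r by rewrite -ltcR -lr.
have r1 : r < 1 by rewrite -ltcR -lr.
have nr (s : R) : 0 < s -> normc (s%:C)%C = s.
  by move=> s0; rewrite /normc/= expr0n/= addr0 sqrtr_sqr gtr0_norm.
rewrite [X in seminorm n X](_ : _ = (r%:C)%C *: (y - x) +
    ((1 - r)%:C)%C *: (z - x)); last first.
  rewrite rmorphB/= -lr !scalerBr addrACA -opprD -scalerDl.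
  by rewrite [l%:num + _]addrC subrK scale1r.
rewrite (le_lt_trans (seminormD _ _ _))// !seminormZ !nr ?subr_gt0//.
rewrite [ltRHS](_ : e = r * e + (1 - r) * e); last by ring.
by rewrite ltrD// ltr_pM2l// subr_gt0.
Qed.

Lemma smlc_locally_convex :
  exists2 S : set_system B, (forall b, b \in S -> convex_set b) & basis S.
Proof.
exists [set b | exists n x e, b = [set y : B | seminorm n (y - x) < e]].
  by move=> b /[!inE]/= -[n [x [e ->]]]; exact: smlc_ball_convex.
split.
  move=> b [n [x [e ->]]]; rewrite openE => y /= xy.
  apply/seminorm_nbhsE; exists n, (e - seminorm n (y - x)).
  split; first by rewrite subr_gt0.
  move=> z zy; rewrite /= (le_lt_trans (seminorm_triangle n y z x))//.
  by rewrite -ltrBrDr.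
move=> x U /seminorm_nbhsE[n [e [e0 eU]]].
exists [set y | seminorm n (y - x) < e] => //; split.
  by exists n, x, e.
by rewrite /= subrr seminorm0.
Qed.

Lemma astarB x y : astar (x - y) = astar x - astar y.
Proof. by rewrite -scaleN1r astarD astarZ rmorphN1 scaleN1r. Qed.

Lemma amulBl x y z : amul (x - y) z = amul x z - amul y z.
Proof. by rewrite -scaleN1r amulDl amulZl scaleN1r. Qed.

Lemma amulBr x y z : amul x (y - z) = amul x y - amul x z.
Proof. by rewrite -scaleN1r amulDr amulZr scaleN1r. Qed.

Lemma astar_continuous : continuous (@astar R B).
Proof.
move=> x; apply/cvg_seminormP => n e e0.
near=> y; rewrite -astarB (le_lt_trans (seminorm_star _ _))//.
by near: y; exact: nbhs_seminorm.
Unshelve. all: by end_near. Qed.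

Lemma amul_continuous : continuous (fun x : B * B => amul x.1 x.2).
Proof.
move=> [x y]; apply/cvg_seminormP => n e e0.
pose X := seminorm n.+1 x; pose Y := seminorm n.+1 y.
have X0 : 0 <= X := seminorm_ge0 _ _; have Y0 : 0 <= Y := seminorm_ge0 _ _.
pose c := 2 + X + Y; have c0 : 0 < c by rewrite /c; lra.
pose d := Num.min 1 (e / c).
have d0 : 0 < d by rewrite lt_min ltr01 !divr_gt0.
exists ([set z | seminorm n.+1 (z - x) < d],
        [set z | seminorm n.+1 (z - y) < d]).
  by split; exact: nbhs_seminorm.
move=> [u v] /= [xu yv].
have -> : amul u v - amul x y =
    amul (u - x) (v - y) + amul (u - x) y + amul x (v - y).
  by rewrite -amulDr subrK amulBl amulBr subrKA.
rewrite (le_lt_trans (seminormD _ _ _))//.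
rewrite (le_lt_trans (lerD (seminormD _ _ _) (lexx _)))//.
have := seminorm_mul n (u - x) (v - y).
have := seminorm_mul n (u - x) y; have := seminorm_mul n x (v - y).
rewrite -/X -/Y.
have := seminorm_ge0 n.+1 (u - x); have := seminorm_ge0 n.+1 (v - y).
have d1 : d <= 1 by rewrite /d ge_min lexx.
have dc : d * c <= e by rewrite -ler_pdivlMr// /d ge_min lexx orbT.
move: dc; rewrite /c => dc; nra.
Unshelve. all: by end_near. Qed.

Lemma seminorm_continuous n : continuous (@seminorm R B n : B -> R).
Proof.
move=> x; apply/cvgrPdist_lt => e e0; near=> y.
have xy : seminorm n (y - x) < e by near: y; exact: nbhs_seminorm.
have := seminorm_triangle n y x 0; have := seminorm_triangle n x y 0.
by rewrite !subr0 (seminormB n x) ltr_distl => ? ?; apply/andP; split; lra.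
Unshelve. all: by end_near. Qed.

Lemma nbhs_dist x (e : R) : 0 < e -> nbhs x [set y | dist x y < e].
Proof. by move=> e0; apply/dist_nbhsE; exists e. Qed.

Lemma distxx x : dist x x = 0. Proof. exact/dist_eq0. Qed.

Lemma dist_ge0 x y : 0 <= dist x y.
Proof.
by rewrite -(@pmulrn_lge0 _ _ 2)// -(distxx x) mulr2n {2}dist_sym dist_triangle.
Qed.

Lemma dist_continuous : continuous (fun x : B * B => dist x.1 x.2).
Proof.
move=> [x y]; apply/cvgrPdist_lt => e e0 /=.
have e20 : 0 < e / 2 by rewrite divr_gt0.
exists ([set z | dist x z < e / 2], [set z | dist y z < e / 2]).
  by split; exact: nbhs_dist.
move=> [u v] /= [xu yv]; rewrite ltr_distl.
have := dist_triangle u x y; have := dist_triangle v u y.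
have := dist_triangle x u v; have := dist_triangle y x v.
by rewrite (dist_sym u x) (dist_sym v y) => *; apply/andP; split; lra.
Qed.

End seminormed_theory.

Section unit_interval.
Context {R : realType}.

Definition unit_interval : set R := `[0, 1].

Definition clamp01 (x : R) : R := Num.max 0 (Num.min 1 x).

Lemma clamp01_in x : clamp01 x \in unit_interval.
Proof.
by rewrite inE /unit_interval/= in_itv/= /clamp01 le_max lexx/= ge_max ler01
  ge_min lexx.
Qed.

Definition to_unit (x : R) : unit_interval :=
  exist _ (clamp01 x) (clamp01_in x).

Lemma val_unit (p : unit_interval) : (0 <= \val p) && (\val p <= 1).
Proof. by case: p => p /=; rewrite inE /unit_interval/= in_itv. Qed.

Lemma to_unitK (p : unit_interval) : to_unit (\val p) = p.
Proof.
apply/val_inj => /=; rewrite /clamp01; have /andP[p0 p1] := val_unit p.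
by rewrite (min_idPr p1) (max_idPr p0).
Qed.

Definition unit0 : unit_interval := to_unit 0.
Definition unit1 : unit_interval := to_unit 1.

Lemma val_unit0 : \val unit0 = 0.
Proof. by rewrite /= /clamp01 (min_idPr ler01) maxxx. Qed.

Lemma val_unit1 : \val unit1 = 1.
Proof. by rewrite /= /clamp01 minxx (max_idPr ler01). Qed.

Lemma to_unit_continuous : continuous to_unit.
Proof.
apply: continuous_comp_initial => x.
have c1 : (fun y : R => Num.min 1 y) @ x --> Num.min 1 x.
  by apply: (@continuous_min R R (fun=> 1) id x);
    [exact: cvg_cst|exact: cvg_id].
by apply: (@continuous_max R R (fun=> 0) (fun y => Num.min 1 y) x) => //;
  exact: cvg_cst.
Qed.

Lemma unit_interval_compact : compact [set: unit_interval].
Proof.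
have -> : [set: unit_interval] = to_unit @` `[0, 1].
  apply/seteqP; split=> // p _; exists (\val p); last exact: to_unitK.
  by have := val_unit p; rewrite /= in_itv.
apply: continuous_compact; last exact: segment_compact.
exact/continuous_subspaceT/to_unit_continuous.
Qed.

Lemma unit_has_sup (r : unit_interval -> R) :
  continuous r -> has_sup (range r).
Proof.
move=> cr; split; first by exists (r unit0), unit0.
have /compact_bounded[M [_ /(_ (M + 1))]] : compact (range r).
  apply: continuous_compact; last exact: unit_interval_compact.
  exact: continuous_subspaceT.
rewrite ltrDl ltr01 => /(_ isT) rM; exists (M + 1) => _ [p _ <-].
by rewrite (le_trans (ler_norm _))// rM//=; exists p.
Qed.

Lemma unit_sup_ub (r : unit_interval -> R) p :
  continuous r -> r p <= sup (range r).
Proof. by move=> /unit_has_sup/sup_upper_bound/ubP; apply; exists p. Qed.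

Lemma unit_sup_le (r : unit_interval -> R) e :
  (forall p, r p <= e) -> sup (range r) <= e.
Proof.
move=> re; apply: ge_sup; first by exists (r unit0), unit0.
by move=> _ [p _ <-].
Qed.

End unit_interval.

(* C([0,1], B), with pointwise operations, the supremum metric and the suprema
   of the seminorms of [B]. *)
Definition cont01 (R : realType) (B : topologicalType) : Type :=
  continuousType (@unit_interval R) B.

HB.instance Definition _ (R : realType) (B : topologicalType) :=
  Choice.copy (cont01 R B) (continuousType (@unit_interval R) B).

Definition cont01_fun (R : realType) (B : topologicalType) (F : cont01 R B) :
  @unit_interval R -> B := (F : continuousType _ _).
Coercion cont01_fun : cont01 >-> Funclass.

Definition mk_cont01 (R : realType) (B : topologicalType)
    (F : @unit_interval R -> B) (Fc : continuous F) : cont01 R B :=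
  (mkcts Fc : continuousType _ _).

Section cont01_pointwise.
Context {R : realType} {B : smlcStarAlgType R}.
Implicit Types F G H : cont01 R B.

Lemma cont01P F G : (forall p, F p = G p) -> F = G.
Proof. by move=> FG; apply/continuousEP. Qed.

Lemma cont01_continuous F : continuous F.
Proof. exact: cts_fun. Qed.

Let comp2_continuous (T : topologicalType) (op : B * B -> T) F G :
  continuous op -> continuous (fun p => op (F p, G p)).
Proof.
move=> opc p; apply: (@continuous_comp _ _ _ (fun p => (F p, G p)) op).
  exact: cvg_pair (@cont01_continuous F p) (@cont01_continuous G p).
exact: opc.
Qed.

Let comp1_continuous (T : topologicalType) (op : B -> T) F :
  continuous op -> continuous (fun p => op (F p)).
Proof.
move=> opc p; apply: (@continuous_comp _ _ _ F op); last exact: opc.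
exact: cont01_continuous.
Qed.

Lemma scaler_continuous (k : R[i]) : continuous (fun x : B => k *: x).
Proof.
move=> x.
apply: (@continuous_comp B ((R[i])^o * B)%type B (fun y => (k, y))
  (fun z => z.1 *: z.2)); last exact: scale_continuous.
by apply: (@cvg_pair _ _ _ _ (nbhs (k : (R[i])^o)));
  [exact: cvg_cst|exact: cvg_id].
Qed.

Let zero_continuous : continuous (fun _ : @unit_interval R => (0 : B)).
Proof. exact: (@cts_fun _ _ (cst (0 : B))). Qed.

Definition cont01_zero : cont01 R B :=
  mk_cont01 zero_continuous.
Definition cont01_opp F : cont01 R B :=
  mk_cont01 (@comp1_continuous B -%R F opp_continuous).
Definition cont01_add F G : cont01 R B :=
  mk_cont01 (@comp2_continuous B (fun x => x.1 + x.2) F G add_continuous).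
Definition cont01_scale (k : R[i]) F : cont01 R B :=
  mk_cont01 (@comp1_continuous B ( *:%R k) F (@scaler_continuous k)).
Definition cont01_mul F G : cont01 R B :=
  mk_cont01 (@comp2_continuous B (fun x => amul x.1 x.2) F G amul_continuous).
Definition cont01_star F : cont01 R B :=
  mk_cont01 (@comp1_continuous B astar F astar_continuous).

Let addA : associative cont01_add.
Proof. by move=> F G H; apply: cont01P => p; exact: addrA. Qed.
Let addC : commutative cont01_add.
Proof. by move=> F G; apply: cont01P => p; exact: addrC. Qed.
Let add0 : left_id cont01_zero cont01_add.
Proof. by move=> F; apply: cont01P => p; exact: add0r. Qed.
Let addN : left_inverse cont01_zero cont01_opp cont01_add.
Proof. by move=> F; apply: cont01P => p; exact: addNr. Qed.

HB.instance Definition _ := GRing.isZmodule.Build (cont01 R B)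
  addA addC add0 addN.

Let scaleA (k l : R[i]) F :
  cont01_scale k (cont01_scale l F) = cont01_scale (k * l) F.
Proof. by apply: cont01P => p; exact: scalerA. Qed.
Let scale1 : left_id 1 cont01_scale.
Proof. by move=> F; apply: cont01P => p; exact: scale1r. Qed.
Let scaleDr : right_distributive cont01_scale +%R.
Proof. by move=> k F G; apply: cont01P => p; exact: scalerDr. Qed.
Let scaleDl F : {morph cont01_scale^~ F : k l / k + l}.
Proof. by move=> k l; apply: cont01P => p; exact: scalerDl. Qed.

HB.instance Definition _ := GRing.Zmodule_isLmodule.Build R[i] (cont01 R B)
  scaleA scale1 scaleDr scaleDl.

Definition cont01_dist F G : R := sup (range (fun p => dist (F p) (G p))).

Definition cont01_seminorm n F : R := sup (range (fun p => seminorm n (F p))).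

Lemma dist_le_cont01 F G p : dist (F p) (G p) <= cont01_dist F G.
Proof.
apply: (unit_sup_ub (r := fun p => dist (F p) (G p))).
exact: (@comp2_continuous R (fun x => dist x.1 x.2) F G dist_continuous).
Qed.

Lemma seminorm_le_cont01 n F p : seminorm n (F p) <= cont01_seminorm n F.
Proof.
apply: (unit_sup_ub (r := fun p => seminorm n (F p))).
exact: (@comp1_continuous R (seminorm n) F (@seminorm_continuous R B n)).
Qed.

Lemma cont01_dist_le F G e :
  (forall p, dist (F p) (G p) <= e) -> cont01_dist F G <= e.
Proof. exact: unit_sup_le. Qed.

Lemma cont01_seminorm_le n F e :
  (forall p, seminorm n (F p) <= e) -> cont01_seminorm n F <= e.
Proof. exact: unit_sup_le. Qed.

Let cdist_eq0 F G : cont01_dist F G = 0 <-> F = G.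
Proof.
split=> [FG|->].
  apply: cont01P => p; apply/dist_eq0/eqP.
  by rewrite eq_le dist_ge0 -FG dist_le_cont01.
apply/eqP; rewrite eq_le; apply/andP; split.
  by apply: cont01_dist_le => p; rewrite distxx.
by rewrite -(distxx (G unit0)) dist_le_cont01.
Qed.

Let cdist_sym F G : cont01_dist F G = cont01_dist G F.
Proof.
by rewrite /cont01_dist; under eq_fun do rewrite dist_sym.
Qed.

Let cdist_triangle G F H : cont01_dist F H <= cont01_dist F G + cont01_dist G H.
Proof.
apply: cont01_dist_le => p; rewrite (le_trans (dist_triangle (G p) _ _))//.
by rewrite lerD// dist_le_cont01.
Qed.

Let cdist_translation H F G : cont01_dist (F + H) (G + H) = cont01_dist F G.
Proof.
by rewrite /cont01_dist; under eq_fun do rewrite /= dist_translation.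
Qed.

Definition cont01_nbhs F : set_system (cont01 R B) :=
  [set U | exists e, 0 < e /\ forall G, cont01_dist F G < e -> U G].

HB.instance Definition _ := hasNbhs.Build (cont01 R B) cont01_nbhs.

Let nbhs_filter F : ProperFilter (nbhs F).
Proof.
have dFF : cont01_dist F F = 0 by exact/cdist_eq0.
split; first by move=> [e [e0 /(_ F)]]; rewrite dFF; exact.
split; first by exists 1; split.
  move=> U V [e [e0 eU]] [d [d0 dV]]; exists (Num.min e d).
  split=> [|G]; rewrite lt_min ?e0// => /andP[? ?].
  by split; [exact: eU|exact: dV].
by move=> U V UV [e [e0 eU]]; exists e; split=> // G /eU/UV.
Qed.

Let nbhs_singleton F (U : set (cont01 R B)) : nbhs F U -> U F.
Proof. by move=> [e [e0]]; apply; rewrite (cdist_eq0 F F).2. Qed.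

Let nbhs_nbhs F (U : set (cont01 R B)) : nbhs F U -> nbhs F (nbhs^~ U).
Proof.
move=> [e [e0 eU]]; exists e; split=> // G FG.
exists (e - cont01_dist F G); split=> [|H GH]; first by rewrite subr_gt0.
by apply: eU; rewrite (le_lt_trans (cdist_triangle G _ _))// -ltrBrDl.
Qed.

HB.instance Definition _ := Nbhs_isNbhsTopological.Build (cont01 R B)
  nbhs_filter nbhs_singleton nbhs_nbhs.

Let mulA F G H :
  cont01_mul F (cont01_mul G H) = cont01_mul (cont01_mul F G) H.
Proof. by apply: cont01P => p; exact: amulA. Qed.
Let mulDl F G H :
  cont01_mul (F + G) H = cont01_mul F H + cont01_mul G H.
Proof. by apply: cont01P => p; exact: amulDl. Qed.
Let mulDr F G H :
  cont01_mul F (G + H) = cont01_mul F G + cont01_mul F H.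
Proof. by apply: cont01P => p; exact: amulDr. Qed.
Let mulZl (k : R[i]) F G : cont01_mul (k *: F) G = k *: cont01_mul F G.
Proof. by apply: cont01P => p; exact: amulZl. Qed.
Let mulZr (k : R[i]) F G : cont01_mul F (k *: G) = k *: cont01_mul F G.
Proof. by apply: cont01P => p; exact: amulZr. Qed.
Let starK F : cont01_star (cont01_star F) = F.
Proof. by apply: cont01P => p; exact: astarK. Qed.
Let starD F G : cont01_star (F + G) = cont01_star F + cont01_star G.
Proof. by apply: cont01P => p; exact: astarD. Qed.
Let starZ (k : R[i]) F : cont01_star (k *: F) = conjc k *: cont01_star F.
Proof. by apply: cont01P => p; exact: astarZ. Qed.
Let starM F G :
  cont01_star (cont01_mul F G) = cont01_mul (cont01_star G) (cont01_star F).
Proof. by apply: cont01P => p; exact: astarM. Qed.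

Let snD n F G :
  cont01_seminorm n (F + G) <= cont01_seminorm n F + cont01_seminorm n G.
Proof.
apply: cont01_seminorm_le => p; rewrite (le_trans (seminormD _ _ _))//.
by rewrite lerD// seminorm_le_cont01.
Qed.

Lemma cont01_seminorm_ge0 n F : 0 <= cont01_seminorm n F.
Proof.
exact: le_trans (seminorm_ge0 n _) (seminorm_le_cont01 n F unit0).
Qed.

Let snZ_le n (k : R[i]) F :
  cont01_seminorm n (k *: F) <= normc k * cont01_seminorm n F.
Proof.
apply: cont01_seminorm_le => p; rewrite seminormZ.
apply: ler_wpM2l; last exact: seminorm_le_cont01.
by case: (k) => a b; exact: sqrtr_ge0.
Qed.

Let snZ n (k : R[i]) F :
  cont01_seminorm n (k *: F) = normc k * cont01_seminorm n F.
Proof.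
apply/eqP; rewrite eq_le snZ_le/=.
have [->|k0] := eqVneq k 0; first by rewrite normc0 mul0r cont01_seminorm_ge0.
have nk : 0 < normc k.
  rewrite lt_neqAle; apply/andP; split.
    by apply: contra k0; rewrite eq_sym => /eqP/eq0_normc ->.
  by case: (k) => a b; exact: sqrtr_ge0.
rewrite -[in leLHS](scalerK k0 F) -ler_pdivlMl// -normcV.
exact: snZ_le.
Qed.

Let sn_leS n F : cont01_seminorm n F <= cont01_seminorm n.+1 F.
Proof.
apply: cont01_seminorm_le => p.
exact: le_trans (seminorm_leS _ _) (seminorm_le_cont01 _ _ _).
Qed.

Let sn_star n F : cont01_seminorm n (cont01_star F) <= cont01_seminorm n.+1 F.
Proof.
apply: cont01_seminorm_le => p.
exact: le_trans (seminorm_star _ _) (seminorm_le_cont01 _ _ _).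
Qed.

Let sn_mul n F G : cont01_seminorm n (cont01_mul F G) <=
  cont01_seminorm n.+1 F * cont01_seminorm n.+1 G.
Proof.
apply: cont01_seminorm_le => p; rewrite (le_trans (seminorm_mul _ _ _))//.
by rewrite ler_pM ?seminorm_ge0// seminorm_le_cont01.
Qed.

Let sn_nbhsE F (U : set (cont01 R B)) :
  nbhs F U <->
  exists n e, 0 < e /\ forall G, cont01_seminorm n (G - F) < e -> U G.
Proof.
split=> [[e [e0 eU]]|[n [e [e0 eU]]]].
  have e20 : 0 < e / 2 by rewrite divr_gt0.
  have [n [d [d0 dU]]] := (seminorm_nbhsE _ _).1 (nbhs_dist (0 : B) e20).
  exists n, d; split=> // G GF; apply: eU.
  rewrite (@le_lt_trans _ _ (e / 2))//; last lra.
  apply: cont01_dist_le => p; rewrite dist_sub ltW//; apply: dU.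
  by rewrite subr0 (le_lt_trans _ GF)// -[leLHS]/(seminorm n ((G - F) p))
    seminorm_le_cont01.
have e20 : 0 < e / 2 by rewrite divr_gt0.
have [d [d0 dU]] := (dist_nbhsE _ _).1 (nbhs_seminorm n (0 : B) e20).
exists d; split=> // G FG; apply: eU.
rewrite (@le_lt_trans _ _ (e / 2))//; last lra.
apply: cont01_seminorm_le => p; rewrite -[leLHS]/(seminorm n (G p - F p)) ltW//.
rewrite -[G p - F p]subr0; apply: dU; rewrite -dist_sub.
exact: le_lt_trans (dist_le_cont01 _ _ _) FG.
Qed.

HB.instance Definition _ := isSeminormedStarAlgebra.Build R (cont01 R B)
  mulA mulDl mulDr mulZl mulZr starK starD starZ starM snD snZ sn_leS sn_star
  sn_mul sn_nbhsE cdist_eq0 cdist_sym cdist_triangle cdist_translation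
  (fun F U => iff_refl _).

HB.instance Definition _ :=
  PreTopologicalNmodule_isTopologicalNmodule.Build (cont01 R B)
    (@smlc_add_continuous R (cont01 R B)).
HB.instance Definition _ :=
  TopologicalNmodule_isTopologicalLmodule.Build R[i] (cont01 R B)
    (@smlc_scale_continuous R (cont01 R B)).
(* This factory only provides the uniform structure. *)
HB.instance Definition _ := PreTopologicalLmod_isTvs.Build R[i] (cont01 R B)
  (@smlc_add_continuous R (cont01 R B)) (@smlc_scale_continuous R (cont01 R B))
  (@smlc_locally_convex R (cont01 R B)).
HB.instance Definition _ := Uniform_isTvs.Build R[i] (cont01 R B)
  (@smlc_locally_convex R (cont01 R B)).

Let heine F (e : R) : 0 < e -> exists N : nat, forall p q : @unit_interval R,
  `|\val p - \val q| < N.+1%:R^-1 -> dist (F p) (F q) < e.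
Proof.
move=> e0; pose f := F \o to_unit.
have cf : continuous f.
  move=> x; apply: (@continuous_comp R _ B to_unit F).
    exact: to_unit_continuous.
  exact: cont01_continuous.
pose P (N : nat) (x : R) :=
  forall y, `|x - y| < N.+1%:R^-1 -> dist (f x) (f y) < e.
have [N _ NP] : \forall N \near \oo, [set` `[0 : R, 1]] `<=` P N.
  move/compact_near_coveringP: (@segment_compact R 0 1); apply=> x _.
 have e20 : 0 < e / 2 by rewrite divr_gt0.
  have /nbhs_ballP[r /= r0 rP] := cf x _ (nbhs_dist (f x) e20).
  have r20 : 0 < r / 2 by rewrite divr_gt0.
  exists (ball x (r / 2), [set N | N.+1%:R^-1 < r / 2]).
    split; first exact: nbhsx_ballx.
    exact: (near_infty_natSinv_lt (PosNum r20)).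
  move=> [x' N] /= []; rewrite -ball_normE/= => xx' Nr y x'y.
  have h1 : dist (f x) (f x') < e / 2 by apply: rP; rewrite -ball_normE/=; lra.
  have h2 : dist (f x) (f y) < e / 2.
    apply: rP; rewrite -ball_normE/=.
    rewrite (le_lt_trans (ler_distD x' x y))// [ltRHS]splitr ltrD//.
    exact: lt_trans x'y Nr.
  by have := dist_triangle (f x) (f x') (f y); rewrite (dist_sym (f x') (f x));
    lra.
exists N => p q pq; have p01 : [set` `[0, 1]] (\val p).
  by rewrite /= in_itv/= val_unit.
by have := NP N (leqnn N) _ p01 _ pq; rewrite /f /= !to_unitK.
Qed.

Let cont01_separable :
  exists2 S : set (cont01 R B), countable S & dense S.
Proof.
have [D /countable_injP[i iI] dD] := @separable R B.
pose e (k : nat) : B := xget 0 [set x | D x /\ i x = k].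
have eP x (d : R) : 0 < d -> exists k, dist x (e k) < d.
  move=> d0; have xx : interior [set y | dist x y < d] x by exact: nbhs_dist.
  have [y [xy Dy]] := dD _ (ex_intro _ x xx) (open_interior _).
  exists (i y); have -> : e (i y) = y.
    rewrite /e; case: xgetP => [z _ [Dz zy]|/(_ y)]; last by case.
    by apply: iI; rewrite ?inE.
  exact: interior_subset xy.
pose fits (c : nat * nat * seq nat) : set (cont01 R B) :=
  [set F | forall p, dist (F p)
     (e (nth 0%N c.2 (Num.truncn (\val p * c.1.1.+1%:R)))) < c.1.2.+1%:R^-1].
exists (range (fun c => xget 0 (fits c))).
  exact: sub_countable (card_image_le _ _) (countableP _).
move=> O [F OF]; rewrite openE => /(_ F OF)[d [d0 dO]].
have d20 : 0 < d / 3 by rewrite divr_gt0.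
have [k _ /(_ k (leqnn k)) kd'] := near_infty_natSinv_lt (PosNum d20).
have kd : k.+1%:R^-1 < d / 3 := kd'.
have k0 : 0 < k.+1%:R^-1 :> R by rewrite invr_gt0.
have k20 : 0 < k.+1%:R^-1 / 2 :> R by rewrite divr_gt0.
have [N NF] := heine F k20.
have /choice[u uP] : forall j : nat, exists m : nat,
    dist (F (to_unit (j%:R / N.+1%:R))) (e m) < k.+1%:R^-1 / 2.
  by move=> j; exact: eP.
pose c := (N, k, mkseq u N.+2).
have cF : fits c F.
  move=> p /=; have /andP[p0 p1] := val_unit p.
  have N0 : 0 < N.+1%:R :> R by rewrite ltr0n.
  pose j := Num.truncn (\val p * N.+1%:R).
  have /andP[j1 j2] : j%:R <= \val p * N.+1%:R < j.+1%:R.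
    by apply: truncn_itv; rewrite mulr_ge0// ltW.
  have jN : (j < N.+2)%N.
    rewrite ltnS -(ler_nat R) (le_trans j1)//.
    by rewrite -[leRHS]mul1r ler_wpM2r// ltW.
  rewrite -/j nth_mkseq//.
  have jp : j%:R / N.+1%:R <= \val p by rewrite ler_pdivrMr.
  have j0 : 0 <= j%:R / N.+1%:R :> R by rewrite divr_ge0// ltW.
  have jv : \val (to_unit (j%:R / N.+1%:R : R)) = j%:R / N.+1%:R.
    by rewrite /= /clamp01 (min_idPr (le_trans jp p1)) (max_idPr j0).
  have h1 : dist (F p) (F (to_unit (j%:R / N.+1%:R))) < k.+1%:R^-1 / 2.
    apply: NF; rewrite jv ger0_norm ?subr_ge0//.
    rewrite ltrBlDr -[X in X + _]mul1r -mulrDl ltr_pdivlMr//.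
    by rewrite nat1r.
  rewrite (le_lt_trans (dist_triangle (F (to_unit (j%:R / N.+1%:R))) _ _))//.
  by rewrite [ltRHS]splitr ltrD.
exists (xget 0 (fits c)); split; last by exists c.
apply: dO; have cG : fits c (xget 0 (fits c)) by exact: xgetI cF.
rewrite (@le_lt_trans _ _ (k.+1%:R^-1 + k.+1%:R^-1))//; last first.
  by rewrite (lt_trans (ltrD kd kd))//; lra.
apply: cont01_dist_le => p.
have := cF p; have := cG p; rewrite /=; set x := e _ => Gx Fx.
rewrite (le_trans (dist_triangle x _ _))// ltW// ltrD//.
by rewrite dist_sym.
Qed.

HB.instance Definition _ := isSeparable.Build (cont01 R B) cont01_separable.

End cont01_pointwise.

(* A family (f_t) with t in [0, oo) is represented by a function on all of [R];
   its values at negative times are never used, and [f t a] stands for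
   f_t(a). *)
Section asymptotic_morphisms.
Context {R : realType}.
Implicit Types A B C : smlcStarAlgType R.

Record is_pbam A B (f : R -> A -> B) : Prop := IsPbam {
  pbam_continuous : {within [set: A] `*` [set` `[0 : R, +oo[],
    continuous (fun x : A * R => f x.2 x.1)} ;
  pbam_bounded : forall a n,
    exists M, forall t : R, 0 <= t -> seminorm n (f t a) <= M ;
  pbam_strongly_continuous : forall (e : R) a, 0 < e ->
    exists eta P : R, [/\ 0 < eta, 0 <= P &
      forall a' (t : R), dist a a' < eta -> P <= t -> dist (f t a) (f t a') < e] ;
  pbam_star : forall a, astar (f t a) - f t (astar a) @[t --> +oo] --> (0 : B) ;
  pbam_scale : forall (k : R[i]) a,
    k *: f t a - f t (k *: a) @[t --> +oo] --> (0 : B) ;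
  pbam_add : forall a a',
    f t a + f t a' - f t (a + a') @[t --> +oo] --> (0 : B) ;
  pbam_mul : forall a a',
    amul (f t a) (f t a') - f t (amul a a') @[t --> +oo] --> (0 : B)
}.

Definition pba_homotopy A C (h : R -> A -> cont01 R C) (k l : R -> A -> C) :=
  [/\ is_pbam k, is_pbam l, is_pbam h &
    forall (t : R) a, 0 <= t -> h t a unit0 = k t a /\ h t a unit1 = l t a].

(* Continuous increasing maps from [0, oo) to itself; increasing is understood
   in the wide sense. *)
Definition is_reparam (phi : R -> R) :=
  [/\ {within [set` `[0 : R, +oo[], continuous phi},
      forall s t : R, 0 <= s -> s <= t -> phi s <= phi t &
      forall t : R, 0 <= t -> 0 <= phi t].

Definition pbam_comp A B C (g : R -> B -> C) (phi : R -> R) (f : R -> A -> B) :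
  R -> A -> C := fun t a => g (phi t) (f t a).

Definition valid_reparam A B C (f : R -> A -> B) (g : R -> B -> C)
    (phi : R -> R) :=
  is_pbam (pbam_comp g phi f) /\
  forall theta, is_reparam theta -> (forall t : R, 0 <= t -> phi t <= theta t) ->
    is_pbam (pbam_comp g theta f) /\
    exists h : R -> A -> cont01 R C,
      (forall (t : R) a p, 0 <= t ->
        h t a p = g (\val p * phi t + (1 - \val p) * theta t) (f t a)) /\
      pba_homotopy h (pbam_comp g theta f) (pbam_comp g phi f).

End asymptotic_morphisms.

(* Main.v *)
Require Import Defs.
Set Warnings "-notation-overridden,-ambiguous-paths,-notation-incompatible-prefix".
From mathcomp Require Import all_boot all_order all_algebra.
From mathcomp Require Import all_classical all_reals all_analysis.
From mathcomp Require Import complex lra.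

(** Write h_(t,s)(a) for g_s(f_t(a)).  For a fixed t the laws of an asymptotic
    morphism hold for h_(t,s) up to the error of f at time t as s grows, and
    that error becomes small as t grows: each law holds in the iterated limit,
    first s to infinity, then t to infinity.  The hypothesis C1 is what lets an
    error made by f pass through g ([comp_follow]), and C3 keeps h bounded, as
    products and multiples by variable scalars require.  The task is to replace
    the iterated limit by the single requirement s >= phi(t).

    Three observations make a diagonal argument possible.

    First, the thresholds on s can be taken locally uniform in t.  Near a time
    t0, f_t(a) is close to b = f_t0(a), and strong asymptotic continuity of g
    at b (or C1) controls g_s on a neighbourhood of b for all large s.  So the
    iterated limit may be taken along the filter [iterated_tail], in which
    (t, s) tends to (t0, +oo) for each large t0.  By compactness of the
    intervals [T, m], a member of this filter has one threshold per integer m,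
    and a continuous increasing phi beats countably many such sequences of
    thresholds ([diagonal_reparam]).

    Secondly, countably many conditions suffice although a, a' and the scalar
    range over uncountable sets.  The limits along [iterated_tail] are locally
    uniform in the point x = (k, a, a') ([comp_near] and the lemmas after it),
    and, A being separable, the space of such x has a countable base, so that it
    is enough to diagonalise over a countable base, the seminorms and the
    rational error bounds
    ([transfer_to_reparam]).  This gives a phi such that all the laws hold
    uniformly in s >= phi(t) as t grows ([exists_uniform]); uniformity in the
    point also yields strong asymptotic continuity.

    Thirdly, such a phi is valid ([uniform_valid]).  If theta >= phi, the times
    p phi(t) + (1 - p) theta(t) all lie above phi(t), so the laws hold uniformly
    in p, that is, for the supremum seminorms of C([0,1], C).  For bounded t the
    set f_[0,T](a) is compact, which bounds h_(t,s)(a) over all s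
    ([comp_bounded_compact]).  Hence the homotopy is a PBAM, and so is its value
    at p = 0, which is the composite along theta. *)

Import Order.TTheory GRing.Theory Num.Theory.
Local Open Scope ring_scope.

Section pbam_composition.
Import numFieldTopology.Exports numFieldNormedType.Exports ComplexField.Normc.
Local Open Scope classical_set_scope.
Local Open Scope ring_scope.
Set Implicit Arguments.
Unset Strict Implicit.
Context {R : realType}.

(** * Asymptotic equality along a filter *)

Section asymptotic_equality.
Context {B : seminormedStarAlgType R} {T : Type}.
Context (F : set_system T) {FF : Filter F}.
Implicit Types (u v w : T -> B) (k l : T -> R[i]).

(** Working with differences that tend to zero as an equivalence relation
    turns every limit below into a chain of transitivity steps. *)
Definition asymp u v := u x - v x @[x --> F] --> (0 : B).

Definition bounded_along u :=
  forall n, exists M, \forall x \near F, seminorm n (u x) <= M.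

Lemma asympP u v : asymp u v <->
  forall n e, 0 < e -> \near F, seminorm n (u F - v F) < e.
Proof.
split=> [/cvg_seminormP uv n e /(uv n) {}uv|uv].
  by apply: filterS uv => x; rewrite subr0.
apply/cvg_seminormP => n e /(uv n) {}uv.
by apply: filterS uv => x; rewrite subr0.
Qed.

(** The metric and the seminorms define the same topology and the metric is
    translation invariant, so either measures the difference. *)
Lemma asymp_distP u v : asymp u v <->
  forall e, 0 < e -> \near F, dist (u F) (v F) < e.
Proof.
split=> [uv e e0|uv U /dist_nbhsE[e [e0 eU]]].
  have {}uv : \forall x \near F, dist 0 (u x - v x) < e.
    exact: uv (nbhs_dist (0 : B) e0).
  by apply: filterS uv => x; rewrite [dist (u x) _]dist_sym (dist_sub (v x)).
rewrite /nbhs/=; have {}uv := uv _ e0; apply: filterS uv => x uvx /=; apply: eU.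
by rewrite -(dist_sub (v x)) dist_sym.
Qed.

Lemma asymp_sym u v : asymp u v -> asymp v u.
Proof.
move=> /asympP uv; apply/asympP => n e /(uv n) {}uv.
by apply: filterS uv => x; rewrite seminormB.
Qed.

Lemma asymp_trans v u w : asymp u v -> asymp v w -> asymp u w.
Proof.
move=> /asympP uv /asympP vw; apply/asympP => n e e0.
have e20 : 0 < e / 2 by rewrite divr_gt0.
near=> x; rewrite (le_lt_trans (seminorm_triangle n (v x) _ _))//.
rewrite [ltRHS]splitr ltrD//.
  by near: x; exact: uv.
by near: x; exact: vw.
Unshelve. all: by end_near. Qed.

Lemma asymp_bounded u v : asymp u v -> bounded_along v -> bounded_along u.
Proof.
move=> /asympP uv vb n; have [M vM] := vb n; exists (1 + M).
have u1 := uv n 1 ltr01.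
near=> x; rewrite -[u x](subrK (v x)) (le_trans (seminormD _ _ _))// lerD//.
  by apply: ltW; near: x.
by near: x.
Unshelve. all: by end_near. Qed.

Lemma asympD u u' v v' : asymp u u' -> asymp v v' ->
  asymp (fun x => u x + v x) (fun x => u' x + v' x).
Proof.
move=> /asympP uv /asympP vw; apply/asympP => n e e0.
have e20 : 0 < e / 2 by rewrite divr_gt0.
near=> x; rewrite opprD addrACA (le_lt_trans (seminormD _ _ _))//.
rewrite [ltRHS]splitr ltrD//.
  by near: x; exact: uv.
by near: x; exact: vw.
Unshelve. all: by end_near. Qed.

Lemma asymp_star u v : asymp u v ->
  asymp (fun x => astar (u x)) (fun x => astar (v x)).
Proof.
move=> /asympP uv; apply/asympP => n e /(uv n.+1) {}uv; apply: filterS uv => x.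
by rewrite -astarB; apply: le_lt_trans; exact: seminorm_star.
Qed.

Lemma bounded_gt0 u n : bounded_along u ->
  exists M, 0 < M /\ \forall x \near F, seminorm n (u x) <= M.
Proof.
move=> /(_ n)[M uM]; exists (Num.max 1 M); split; first by rewrite lt_max ltr01.
by apply: filterS uM => x ux; rewrite le_max ux orbT.
Qed.

(** One of the two factors has to stay bounded in each term of
    u v - u' v' = (u - u') v + u' (v - v'). *)
Lemma asympM u u' v v' : asymp u u' -> asymp v v' ->
  bounded_along u' -> bounded_along v' ->
  asymp (fun x => amul (u x) (v x)) (fun x => amul (u' x) (v' x)).
Proof.
move=> uu' vv' u'b v'b; have vb := asymp_bounded vv' v'b.
move/asympP : uu' => uu'; move/asympP : vv' => vv'; apply/asympP => n e e0.
have [M [M0 u'M]] := bounded_gt0 n.+1 u'b; have [N [N0 vN]] := bounded_gt0 n.+1 vb.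
have eN0 : 0 < e / 2 / N by rewrite !divr_gt0.
have eM0 : 0 < e / 2 / M by rewrite !divr_gt0.
have {}uu' := uu' n.+1 _ eN0; have {}vv' := vv' n.+1 _ eM0.
near=> x.
have -> : amul (u x) (v x) - amul (u' x) (v' x) =
    amul (u x - u' x) (v x) + amul (u' x) (v x - v' x).
  by rewrite amulBl amulBr subrKA.
rewrite (le_lt_trans (seminormD _ _ _))// [ltRHS]splitr ltr_leD//.
  rewrite (le_lt_trans (seminorm_mul _ _ _))//.
  rewrite (@le_lt_trans _ _ (seminorm n.+1 (u x - u' x) * N))//.
    by rewrite ler_wpM2l ?seminorm_ge0//; near: x.
  by rewrite -ltr_pdivlMr//; near: x.
rewrite (le_trans (seminorm_mul _ _ _))//.
rewrite (@le_trans _ _ (M * seminorm n.+1 (v x - v' x)))//.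
  by rewrite ler_wpM2r ?seminorm_ge0//; near: x.
by rewrite mulrC -ler_pdivlMr// ltW//; near: x.
Unshelve. all: by end_near. Qed.

Lemma normc_ge0 (c : R[i]) : 0 <= normc c.
Proof. by case: c => a b; exact: sqrtr_ge0. Qed.

(** The scalar may vary too: this is what makes homogeneity locally uniform
    in the scalar. *)
Lemma asympZ k (c : R[i]) u u' : asymp u u' -> bounded_along u' ->
  (forall e, 0 < e -> \forall x \near F, normc (k x - c) < e) ->
  asymp (fun x => k x *: u x) (fun x => c *: u' x).
Proof.
move=> uu' u'b kc; have ub := asymp_bounded uu' u'b.
move/asympP : uu' => uu'; apply/asympP => n e e0.
have [N [N0 uN]] := bounded_gt0 n ub.
have c0 : 0 < 1 + normc c by rewrite ltr_pwDl ?normc_ge0.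
have eN0 : 0 < e / 2 / N by rewrite !divr_gt0.
have ec0 : 0 < e / 2 / (1 + normc c) by rewrite !divr_gt0.
have {}uu' := uu' n _ ec0; have {}kc := kc _ eN0.
near=> x.
have -> : k x *: u x - c *: u' x = (k x - c) *: u x + c *: (u x - u' x).
  by rewrite scalerBl scalerBr subrKA.
rewrite (le_lt_trans (seminormD _ _ _))// [ltRHS]splitr ltr_leD// seminormZ.
  rewrite (@le_lt_trans _ _ (normc (k x - c) * N))//.
    by rewrite ler_wpM2l ?normc_ge0//; near: x.
  by rewrite -ltr_pdivlMr//; near: x.
rewrite (@le_trans _ _ ((1 + normc c) * seminorm n (u x - u' x)))//.
  by rewrite ler_wpM2r ?seminorm_ge0// lerDr.
by rewrite mulrC -ler_pdivlMr// ltW//; near: x.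
Unshelve. all: by end_near. Qed.

Lemma cvg_dist u b e :
  u @ F --> b -> 0 < e -> \forall x \near F, dist b (u x) < e.
Proof. by move=> ub e0; exact: ub (nbhs_dist b e0). Qed.

End asymptotic_equality.

Lemma asymp_comp (B : seminormedStarAlgType R) (S T : Type)
    (G : set_system S) (F : set_system T) (p : S -> T) (u v : T -> B) :
  p @ G --> F -> asymp F u v ->
  asymp G (fun x => u (p x)) (fun x => v (p x)).
Proof. by move=> pF uv; apply: (cvg_comp _ _ pF uv). Qed.

(** * Families clamped at time zero *)

(* Times are real numbers while continuity is known on [0, +oo[ only; composing
   with the retraction t |-> max 0 t gives functions continuous everywhere that
   agree with the given ones at nonnegative times. *)

Lemma halflineP (t : R) : [set` `[0 : R, +oo[] t <-> 0 <= t.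
Proof. by rewrite /= in_itv/= andbT. Qed.

Lemma clamp_continuous : continuous (fun t : R => Num.max 0 t).
Proof.
move=> t; apply: (@continuous_max R _ (fun=> 0) id t); first exact: cvg_cst.
exact: cvg_id.
Qed.

Lemma retract_continuous (X Y : topologicalType) (D : set X) (F : X -> Y)
    (r : X -> X) : (forall x, D (r x)) -> continuous r ->
  {within D, continuous F} -> continuous (F \o r).
Proof.
move=> rD rc /subspace_continuousP Fc x.
have rD' : r y @[y --> x] --> within D (nbhs (r x)).
  move=> U cU; have := rc x _ cU; rewrite !nbhs_simpl/=.
  by apply: filterS => y /(_ (rD y)).
exact: cvg_comp _ _ rD' (Fc _ (rD x)).
Qed.

Lemma reparam_clamp_continuous (phi : R -> R) : is_reparam phi ->
  continuous (fun t : R => phi (Num.max 0 t) : R).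
Proof.
move=> [phic _ _]; apply: (retract_continuous _ clamp_continuous phic) => t.
by apply/halflineP; rewrite le_max lexx.
Qed.

Lemma pbam_clamp_continuous (A B : smlcStarAlgType R) (f : R -> A -> B) :
  is_pbam f -> continuous (fun x : A * R => f (Num.max 0 x.2) x.1).
Proof.
move=> /pbam_continuous fc.
pose r (x : A * R) : A * R := (x.1, Num.max 0 x.2).
apply: (@retract_continuous _ _ _ _ r) fc => [x|x].
  by split=> //; apply/halflineP => /=; rewrite le_max lexx.
have x2 : snd @ x --> x.2 by exact: cvg_snd.
exact: cvg_pair cvg_fst (cvg_comp _ _ x2 (@clamp_continuous x.2)).
Qed.

(** * One morphism near a fixed time, composed with large times *)

(** Local uniformity in the first time, the second one being large: the pair
    (t, s) tends to (t0, +oo). *)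
Definition tail_at (t0 : R) : set_system (R * R) :=
  filter_prod (nbhs t0) (pinfty_nbhs R).

Lemma near_tail_at_fst (t0 : R) (U : set R) :
  nbhs t0 U -> \forall z \near tail_at t0, U z.1.
Proof. exact: cvg_fst. Qed.

Lemma near_tail_at_ge (t0 P : R) : \forall z \near tail_at t0, P <= z.2.
Proof.
have : nbhs +oo [set s : R | P <= s] by exact: nbhs_pinfty_ge (num_real P).
exact: (@cvg_snd _ _ (nbhs t0)).
Qed.

Section one_morphism.
Context {A B : smlcStarAlgType R} (f : R -> A -> B) (fP : is_pbam f).

Lemma pbam_cvg (a : A) (t0 : R) : 0 < t0 -> f t a @[t --> t0] --> f t0 a.
Proof.
move=> t00; have := @pbam_clamp_continuous _ _ _ fP (a, t0).
rewrite /continuous_at /= max_r ?ltW// => fc.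
have pc : (a, t) @[t --> t0] --> (a, t0).
  exact: cvg_pair (@cvg_cst A a _ (nbhs t0) _) (@cvg_id _ (nbhs t0)).
have := cvg_comp _ _ pc fc; apply: cvg_trans; apply: near_eq_cvg.
near=> t => /=; rewrite max_r//; near: t; exact: lt_le_nbhsr.
Unshelve. all: by end_near. Qed.

(** Strong asymptotic continuity says that f_s(b) hardly depends on b near
    v(t0) once s is large.  It makes the pointwise laws of a PBAM locally uniform
    along the path v in the lemmas that follow: replace v(t) by v(t0), apply the
    law at v(t0), and go back. *)
Lemma pbam_asymp_at (t0 : R) (v : R -> A) : v @ t0 --> v t0 ->
  asymp (tail_at t0) (fun z => f z.2 (v z.1)) (fun z => f z.2 (v t0)).
Proof.
move=> vc; apply/asymp_distP => e e0.
have [eta [P [eta0 _ fP']]] := pbam_strongly_continuous fP (v t0) e0.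
have vt : \forall z \near tail_at t0, dist (v t0) (v z.1) < eta.
  exact: near_tail_at_fst (cvg_dist vc eta0).
have Pt := near_tail_at_ge t0 P.
by near=> z; rewrite dist_sym; apply: fP'; near: z.
Unshelve. all: by end_near. Qed.

Lemma pbam_bounded_at (t0 : R) (v : R -> A) : v @ t0 --> v t0 ->
  bounded_along (tail_at t0) (fun z => f z.2 (v z.1)).
Proof.
move=> /pbam_asymp_at /asymp_bounded; apply=> n.
have [M fM] := pbam_bounded fP (v t0) n; exists M.
have t0P := near_tail_at_ge t0 0.
by near=> z; apply: fM; near: z.
Unshelve. all: by end_near. Qed.

Lemma asymp_snd (t0 : R) (u v : R -> B) : asymp (pinfty_nbhs R) u v ->
  asymp (tail_at t0) (fun z => u z.2) (fun z => v z.2).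
Proof. by move=> uv; apply: asymp_comp uv; exact: cvg_snd. Qed.

Lemma pbam_star_at (t0 : R) (v : R -> A) : v @ t0 --> v t0 ->
  asymp (tail_at t0) (fun z => astar (f z.2 (v z.1)))
    (fun z => f z.2 (astar (v z.1))).
Proof.
move=> vc; have vc' : astar (v t) @[t --> t0] --> astar (v t0).
  exact: (cvg_comp _ _ vc (@astar_continuous R A (v t0))).
apply: asymp_trans (asymp_star (pbam_asymp_at vc)) _.
apply: asymp_trans _ (asymp_sym (pbam_asymp_at vc')).
exact: (asymp_snd _ (pbam_star fP (v t0))).
Qed.

Lemma pbam_scale_at (t0 : R) (k : R[i]) (v : R -> A) : v @ t0 --> v t0 ->
  asymp (tail_at t0) (fun z => k *: f z.2 (v z.1))
    (fun z => f z.2 (k *: v z.1)).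
Proof.
move=> vc; have vc' : k *: (v t) @[t --> t0] --> k *: (v t0).
  exact: (cvg_comp _ _ vc (@Defs.scaler_continuous R A k (v t0))).
apply: asymp_trans _ (asymp_sym (pbam_asymp_at vc')).
apply: asymp_trans _ (asymp_snd _ (pbam_scale fP k (v t0))).
apply: asympZ => [||e e0]; first exact: pbam_asymp_at.
  by apply: (pbam_bounded_at (v := fun=> v t0)); exact: cvg_cst.
by near=> z; rewrite subrr normc0.
Unshelve. all: by end_near. Qed.

Lemma pbam_add_at (t0 : R) (v w : R -> A) :
  v @ t0 --> v t0 -> w @ t0 --> w t0 ->
  asymp (tail_at t0) (fun z => f z.2 (v z.1) + f z.2 (w z.1))
    (fun z => f z.2 (v z.1 + w z.1)).
Proof.
move=> vc wc; have vc' : v t + w t @[t --> t0] --> v t0 + w t0.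
  exact: cvg_comp _ _ (cvg_pair vc wc) (@smlc_add_continuous R A (v t0, w t0)).
apply: asymp_trans (asympD (pbam_asymp_at vc) (pbam_asymp_at wc)) _.
apply: asymp_trans _ (asymp_sym (pbam_asymp_at vc')).
exact: (asymp_snd _ (pbam_add fP (v t0) (w t0))).
Qed.

Lemma pbam_mul_at (t0 : R) (v w : R -> A) :
  v @ t0 --> v t0 -> w @ t0 --> w t0 ->
  asymp (tail_at t0) (fun z => amul (f z.2 (v z.1)) (f z.2 (w z.1)))
    (fun z => f z.2 (amul (v z.1) (w z.1))).
Proof.
move=> vc wc; have vc' : amul (v t) (w t) @[t --> t0] --> amul (v t0) (w t0).
  exact: cvg_comp _ _ (cvg_pair vc wc) (@amul_continuous R A (v t0, w t0)).
apply: asymp_trans _ (asymp_sym (pbam_asymp_at vc')).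
apply: asymp_trans _ (asymp_snd _ (pbam_mul fP (v t0) (w t0))).
apply: asympM; [exact: pbam_asymp_at|exact: pbam_asymp_at| |].
  by apply: (pbam_bounded_at (v := fun=> v t0)); exact: cvg_cst.
by apply: (pbam_bounded_at (v := fun=> w t0)); exact: cvg_cst.
Qed.

End one_morphism.

(** * The filter of iterated limits *)

(** The iterated limit: s tends to infinity, locally uniformly in t, and then
    t tends to infinity. *)
Definition iterated_tail : set_system (R * R) :=
  [set W | \forall t0 \near +oo, \forall z \near tail_at t0, W z].

#[global] Instance iterated_tail_filter : Filter iterated_tail.
Proof.
split=> [|V W EV EW|V W VW EV].
- by apply: nearW => t0; exact: filterT.
- rewrite /iterated_tail/=; near=> t0.
  have t0V : \forall z \near tail_at t0, V z by near: t0.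
  have t0W : \forall z \near tail_at t0, W z by near: t0.
  by near=> z; split; near: z.
- rewrite /iterated_tail/=; near=> t0.
  have t0V : \forall z \near tail_at t0, V z by near: t0.
  by near=> z; apply: VW; near: z.
Unshelve. all: by end_near. Qed.

Lemma near_iterated (W : set (R * R)) :
  (\forall t0 \near +oo, \forall z \near tail_at t0, W z) ->
  \forall z \near iterated_tail, W z.
Proof. by []. Qed.

Lemma iterated_tail_fst : fst @ iterated_tail --> +oo.
Proof.
move=> U [M [_ MU]]; apply: near_iterated.
near=> t0; have Mt0 : M < t0 by near: t0; apply: nbhs_pinfty_gt; exact: num_real.
have : \forall t \near t0, M < t by exact: lt_nbhsr.
move=> /near_tail_at_fst t0M; near=> z; apply: MU.
by near: z.
Unshelve. all: by end_near. Qed.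

(** What holds as s grows near each fixed time holds in the iterated limit;
    positive times are enough, and f is continuous there in the full sense. *)
Lemma asymp_iterated (B : smlcStarAlgType R) (u v : R * R -> B) :
  (forall t0, 0 < t0 -> asymp (tail_at t0) u v) -> asymp iterated_tail u v.
Proof.
move=> uv; apply/asympP => n e e0; apply: near_iterated.
near=> t0; have t00 : 0 < t0 by near: t0; apply: nbhs_pinfty_gt; exact: num_real.
by have /asympP := uv t0 t00; exact.
Unshelve. all: by end_near. Qed.

(** * Diagonalisation by a reparameterisation *)

Section majorant.
Variables (u : nat -> R) (u0 : forall k, 0 <= u k).

(** The k-th ramp starts at time k - 1 and is at least u k from time k on. *)
Definition ramp (k : nat) (t : R) : R := u k * Num.max 0 (t - k%:R + 1).

(** A locally finite sum of ramps: those with k > t + 1 vanish at time t. *)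
Definition ramp_sum (t : R) : R := \sum_(0 <= k < (Num.truncn t).+2) ramp k t.

Lemma ramp_ge0 k t : 0 <= ramp k t.
Proof. by rewrite mulr_ge0// le_max lexx. Qed.

(** The number of terms may be fixed locally, or for two times at once, and
    then continuity and monotonicity are those of the ramps. *)
Lemma ramp_sumE N t : t < N%:R -> ramp_sum t = \sum_(0 <= k < N.+1) ramp k t.
Proof.
have tail m n : t < m%:R -> (m <= n)%N ->
    \sum_(0 <= k < n.+1) ramp k t = \sum_(0 <= k < m.+1) ramp k t.
  move=> tm mn; rewrite (@big_cat_nat _ _ _ m.+1 0 n.+1)//= [X in _ + X]big_nat.
  rewrite [X in _ + X]big1 ?addr0// => k /andP[mk _].
  have : m.+1%:R <= k%:R :> R by rewrite ler_nat.
  rewrite -natr1 => mk'; rewrite /ramp (max_idPl _) ?mulr0//; lra.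
move=> tN; have tt : t < (Num.truncn t).+1%:R by exact: truncnS_gt.
by case: (leqP N (Num.truncn t).+1) => Nt; rewrite /ramp_sum;
  [|apply/esym]; apply: tail => //; exact: ltnW.
Qed.

Lemma ramp_sum_continuous : continuous ramp_sum.
Proof.
move=> t0; have t0N : t0 < (Num.truncn t0).+1%:R by exact: truncnS_gt.
rewrite /continuous_at (ramp_sumE t0N).
have : (fun t => \sum_(0 <= k < (Num.truncn t0).+2) ramp k t) @ t0 -->
    \sum_(0 <= k < (Num.truncn t0).+2) ramp k t0.
  apply: cvg_big => [|k _]; first exact: add_continuous.
  have linc : t - k%:R + 1 @[t --> t0] --> t0 - k%:R + 1.
    by apply: cvgD; [apply: cvgB; [exact: cvg_id|]|]; exact: cvg_cst.
  have maxc : Num.max 0 (t - k%:R + 1) @[t --> t0] --> Num.max 0 (t0 - k%:R + 1).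
    by apply: (continuous_max (f := fun=> 0) _ linc); exact: cvg_cst.
  exact: cvgM (cvg_cst _) maxc.
apply: cvg_trans; apply: near_eq_cvg.
near=> t; rewrite -ramp_sumE//; near: t; exact: lt_nbhsl.
Unshelve. all: by end_near. Qed.

Lemma ramp_sum_reparam : is_reparam ramp_sum.
Proof.
split=> [|s t _ st|t _].
- exact/continuous_subspaceT/ramp_sum_continuous.
- have tN : t < (Num.truncn t).+1%:R by exact: truncnS_gt.
  rewrite (ramp_sumE tN) (ramp_sumE (le_lt_trans st tN)).
  apply: ler_sum => k _; rewrite ler_wpM2l// ge_max le_max lexx/=.
  by rewrite le_max lerD2r lerD2r st orbT.
- by apply: sumr_ge0 => k _; exact: ramp_ge0.
Qed.

Lemma ramp_sum_ge k t : k%:R <= t -> u k <= ramp_sum t.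
Proof.
move=> kt; have tN : t < (Num.truncn t).+1%:R by exact: truncnS_gt.
have kN : (k < (Num.truncn t).+2)%N.
  by rewrite ltnW// ltnS -(ltr_nat R) (le_lt_trans kt).
rewrite /ramp_sum big_mkord (bigD1 (Ordinal kN))//=.
rewrite ler_wpDr ?sumr_ge0// => [i _|]; first exact: ramp_ge0.
by rewrite -[leLHS]mulr1 ler_wpM2l// le_max; apply/orP; right; lra.
Qed.

End majorant.

(** The single limit that is to replace the iterated one: t tends to infinity
    and s ranges over all values above phi(t), with no rate attached. *)
Definition tail_above (phi : R -> R) : set_system (R * R) :=
  [set W | \forall t \near +oo, forall s, phi t <= s -> W (t, s)].

#[global] Instance tail_above_filter phi : Filter (tail_above phi).
Proof.
split=> [|V W EV EW|V W VW EV].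
- exact: nearW.
- move: EV EW; rewrite /tail_above/= => EV EW; near=> t => s ts.
  by split; [apply: (near EV t)|apply: (near EW t)].
- move: EV; rewrite /tail_above/= => EV; near=> t => s ts; apply: VW.
  by apply: (near EV t).
Unshelve. all: by end_near. Qed.

(** Compactness of [T + 1, m] turns local thresholds on s into one threshold
    for each m. *)
Lemma iterated_tail_threshold (W : set (R * R)) : iterated_tail W ->
  exists T (S : nat -> R), forall m t s, T <= t -> t <= m%:R -> S m <= s ->
    W (t, s).
Proof.
move=> [T [_ TW]]; exists (T + 1).
suff /choice[S SW] : forall m : nat, exists S : R,
    forall t s : R, T + 1 <= t -> t <= m%:R -> S <= s -> W (t, s).
  by exists S.
move=> m; have /compact_near_coveringP cov := @segment_compact R (T + 1) m%:R.
have : \forall s \near +oo, [set` `[T + 1, m%:R]] `<=` (fun t => W (t, s)).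
  apply: cov => t /=; rewrite in_itv/= => /andP[Tt _].
  have Tt' : T < t by lra.
  have /= := TW t Tt'.
  by rewrite /prop_near1; apply: filterS => -[].
move=> [S [_ SW]]; exists (S + 1) => t s Tt tm Ss; apply: (SW s); first lra.
by rewrite /= in_itv/= Tt tm.
Qed.

(** The diagonal argument.  At time t in [k, k + 1) the reparameterisation
    exceeds the thresholds over [T, k + 1] of the first k + 1 conditions, so every
    condition is eventually taken into account. *)
Lemma diagonal_reparam (I : countType) (W : I -> set (R * R)) :
  exists phi, is_reparam phi /\
    forall i, iterated_tail (W i) -> tail_above phi (W i).
Proof.
have /choice[TS TSW] : forall i, exists TS : R * (nat -> R),
    iterated_tail (W i) -> forall m t s, TS.1 <= t -> t <= m%:R ->
      TS.2 m <= s -> W i (t, s).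
  move=> i.
  have [/iterated_tail_threshold[T [S TSW]]|nW] := pselect (iterated_tail (W i)).
    by exists (T, S).
  by exists (0, fun=> 0).
(* Numbers that do not code an index contribute no threshold. *)
pose S (j m : nat) : R :=
  if unpickle j is Some i then Num.max 0 ((TS i).2 m) else 0.
have S0 j m : 0 <= S j m.
  by rewrite /S; case: unpickle => // i; rewrite le_max lexx.
pose u k := \sum_(j < k.+1) S j k.+1.
have u0 k : 0 <= u k by exact: sumr_ge0.
exists (ramp_sum u); split; first exact: ramp_sum_reparam.
move=> i /TSW iW; rewrite /tail_above/=; near=> t => s us.
have t0 : 0 <= t by near: t; apply: nbhs_pinfty_ge; exact: num_real.
have it : (pickle i)%:R <= t by near: t; apply: nbhs_pinfty_ge; exact: num_real.
have Tt : (TS i).1 <= t by near: t; apply: nbhs_pinfty_ge; exact: num_real.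
have /andP[kt tk] := truncn_itv t0; set k := Num.truncn t in kt tk.
apply: (iW k.+1) => //; first exact: ltW.
have ik : (pickle i < k.+1)%N by rewrite -(ltr_nat R) (le_lt_trans it).
apply: le_trans (le_trans (ramp_sum_ge u0 kt) us).
rewrite /u (bigD1 (Ordinal ik))//= {1}/S pickleK.
by rewrite ler_wpDr ?sumr_ge0// le_max lexx orbT.
Unshelve. all: by end_near. Qed.

(** * Countable bases *)

(** Second countability, phrased with neighbourhoods that need not be open:
    this is the form in which it passes to products and is used. *)
Definition countably_based (X : topologicalType) :=
  exists (J : countType) (V : J -> set X), forall (x : X) U, nbhs x U ->
    exists2 j, nbhs x (V j) & V j `<=` U.

(** One reparameterisation serves all points x: the condition at x holds on
    some basic neighbourhood of x, and there are countably many pairs of a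
    condition and a basic neighbourhood. *)
Lemma transfer_to_reparam (X : topologicalType) (K : countType)
    (P : K -> X -> set (R * R)) : countably_based X ->
  exists phi, is_reparam phi /\ forall k (x : X),
    (\forall y \near filter_prod (nbhs x) iterated_tail, P k y.1 y.2) ->
    \forall y \near filter_prod (nbhs x) (tail_above phi), P k y.1 y.2.
Proof.
move=> [J [V VP]].
have [phi [rphi phiW]] := diagonal_reparam
  (fun kj : K * J => [set z | forall y, V kj.2 y -> P kj.1 y z]).
exists phi; split=> // k x [[U W] /= [xU EW] UW].
have [j xj jU] := VP _ _ xU.
exists (V j, [set z | forall y, V j y -> P k y z]) => /=.
  split=> //; apply: (phiW (k, j)) => /=.
  by apply: filterS EW => z Wz y /jU Uy; exact: (UW (y, z)).
by move=> [y z] /= [Vy]; exact.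
Qed.

Lemma near_slice (X : topologicalType) (G : set_system (R * R)) (FG : Filter G)
    (x : X) (Q : X * (R * R) -> Prop) :
  (\forall y \near filter_prod (nbhs x) G, Q y) -> \forall z \near G, Q (x, z).
Proof.
move=> [[U W] /= [/nbhs_singleton Ux GW] UW].
by apply: filterS GW => z Wz; exact: (UW (x, z)).
Qed.

Lemma countably_based_prod (X Y : topologicalType) :
  countably_based X -> countably_based Y -> countably_based (X * Y)%type.
Proof.
move=> [I [V VP]] [J [W WP]].
exists (I * J)%type, (fun ij => V ij.1 `*` W ij.2) => -[x y] U.
move=> [[U1 U2] /= [xU1 yU2] U12].
have [i xi iU] := VP _ _ xU1; have [j yj jU] := WP _ _ yU2.
exists (i, j); first by exists (V i, W j).
by move=> [x' y'] /= [/iU x'U /jU y'U]; exact: U12.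
Qed.

Lemma countably_based_smlc (A : smlcStarAlgType R) : countably_based A.
Proof.
have [D /countable_injP[i iI] dD] := @separable R A.
pose e (k : nat) : A := xget 0 [set x | D x /\ i x = k].
have eP x (d : R) : 0 < d -> exists k, dist x (e k) < d.
  move=> d0; have xx : interior [set y | dist x y < d] x by exact: nbhs_dist.
  have [y [xy Dy]] := dD _ (ex_intro _ x xx) (open_interior _).
  exists (i y); have -> : e (i y) = y.
    rewrite /e; case: xgetP => [z _ [Dz zy]|/(_ y)]; last by case.
    by apply: iI; rewrite ?inE.
  exact: interior_subset xy.
exists (nat * nat)%type, (fun c => [set y | dist (e c.1) y < c.2.+1%:R^-1]).
move=> x U /dist_nbhsE[d [d0 dU]]; have d20 : 0 < d / 2 by rewrite divr_gt0.
have [m _ /(_ m (leqnn m)) md'] := near_infty_natSinv_lt (PosNum d20).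
have md : m.+1%:R^-1 < d / 2 := md'.
have m0 : 0 < m.+1%:R^-1 :> R by rewrite invr_gt0.
have [k xk] := eP x _ m0.
exists (k, m) => /=.
  apply/dist_nbhsE; exists (m.+1%:R^-1 - dist x (e k)).
  split; first by rewrite subr_gt0.
  move=> y xy /=; rewrite (le_lt_trans (dist_triangle x _ _))//.
  by rewrite (dist_sym (e k)) -ltrBrDl.
move=> y ky; apply: dU; rewrite (le_lt_trans (dist_triangle (e k) _ _))//.
by rewrite [ltRHS]splitr ltrD// (lt_trans _ md).
Qed.

(** The topology of the complex field has complex radii; real ones suffice. *)
Lemma nbhs_normcP (c : R[i]) (U : set R[i]) : nbhs (c : (R[i])^o) U <->
  exists2 e : R, 0 < e & forall k, normc (k - c) < e -> U k.
Proof.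
split=> [/nbhs_ballP[e /= e0 eU]|[e e0 eU]].
  have er : (complex.Re e)%:C%C = e by apply: RRe_real; exact: gtr0_real.
  exists (complex.Re e) => [|k ck]; first by rewrite -ltcR er.
  by apply: eU; rewrite -ball_normE/= -er distrC ltcR.
apply/nbhs_ballP; exists (e%:C)%C => [|k]; first by rewrite /= ltcR.
by rewrite -ball_normE/= distrC ltcR => /eU.
Qed.

Lemma normc_le_norm (x y : R) : normc (x +i* y)%C <= `|x| + `|y|.
Proof.
rewrite -[leRHS]ger0_norm ?addr_ge0// -sqrtr_sqr /normc ler_sqrt ?sqr_ge0//.
rewrite sqrrD !real_normK ?num_real// lerD2r lerDl mulrn_wge0// mulr_ge0//.
Qed.

Lemma countably_based_complex : countably_based (R[i])^o.
Proof.
pose e (c : rat * rat) : R[i] := (ratr c.1 +i* ratr c.2)%C.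
exists (rat * rat * nat)%type, (fun c => [set y | normc (y - e c.1) < c.2.+1%:R^-1]).
move=> x U /nbhs_normcP[d d0 dU]; have d20 : 0 < d / 2 by rewrite divr_gt0.
have [m _ /(_ m (leqnn m)) md'] := near_infty_natSinv_lt (PosNum d20).
have md : m.+1%:R^-1 < d / 2 := md'.
have m0 : 0 < m.+1%:R^-1 :> R by rewrite invr_gt0.
move: m0 md; set r := m.+1%:R^-1 => m0 md.
have approx (y : R) : exists p : rat, `|y - ratr p| < r / 2.
  have [|p] := @rat_in_itvoo R (y - r / 2) (y + r / 2); first by lra.
  rewrite in_itv/= => /andP[? ?]; exists p.
  by rewrite ltr_distl; apply/andP; split; lra.
have [p xp] := approx (complex.Re x); have [q xq] := approx (complex.Im x).
have xe : normc (x - e (p, q)) < r.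
  case: x xp xq {dU} => a b /= ap bq.
  by rewrite (le_lt_trans (normc_le_norm _ _))//; lra.
exists (p, q, m) => /=.
  apply/nbhs_normcP; exists (r - normc (x - e (p, q))).
    by rewrite subr_gt0.
  move=> k kx /=; rewrite -(subrKA x) (le_lt_trans (le_normcD _ _))//.
  by rewrite -/r; lra.
move=> k /= ke; apply: dU; rewrite -(subrKA (e (p, q))).
rewrite (le_lt_trans (le_normcD _ _))//.
by rewrite -[e _ - x]opprB normcN; move: ke; rewrite -/r; lra.
Qed.

(** * Paths in the target algebra *)

(** By compactness of [0, 1], joint continuity gives continuity for the
    supremum metric. *)
Lemma curry_cont01_continuous (X : topologicalType) (B : smlcStarAlgType R)
    (H : X -> cont01 R B) :
  continuous (fun y : X * @unit_interval R => H y.1 y.2) -> continuous H.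
Proof.
move=> Hc x0 U /dist_nbhsE[e [e0 eU]].
have e20 : 0 < e / 2 by rewrite divr_gt0.
have e40 : 0 < e / 2 / 2 by rewrite divr_gt0.
have /compact_near_coveringP cov := @unit_interval_compact R.
have : \forall x \near x0, [set: @unit_interval R] `<=`
    (fun p => dist (H x0 p) (H x p) < e / 2).
  apply: cov => p0 _.
  have pc : (x0, p) @[p --> p0] --> (x0, p0).
    exact: cvg_pair (@cvg_cst X x0 _ (nbhs p0) _) (@cvg_id _ (nbhs p0)).
  have near0 : \forall p \near p0, dist (H x0 p0) (H x0 p) < e / 2 / 2.
    exact: cvg_dist (cvg_comp _ _ pc (Hc (x0, p0))) e40.
  have sw : (y.2, y.1) @[y --> filter_prod (nbhs p0) (nbhs x0)] --> (x0, p0).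
    exact: cvg_pair cvg_snd cvg_fst.
  have near1 : \forall y \near filter_prod (nbhs p0) (nbhs x0),
      dist (H x0 p0) (H y.2 y.1) < e / 2 / 2.
    exact: cvg_dist (cvg_comp _ _ sw (Hc (x0, p0))) e40.
  have near0' : \forall y \near filter_prod (nbhs p0) (nbhs x0),
      dist (H x0 p0) (H x0 y.1) < e / 2 / 2 by exact: cvg_fst near0.
  near=> y => /=; rewrite (le_lt_trans (dist_triangle (H x0 p0) _ _))//.
  rewrite [ltRHS]splitr ltrD//; last by near: y.
  by rewrite dist_sym; near: y.
apply: filterS => x x0x; apply: eU; apply: (@le_lt_trans _ _ (e / 2)); last lra.
by apply: cont01_dist_le => p; exact/ltW/x0x.
Unshelve. all: by end_near. Qed.

Lemma eval_cont01_continuous (B : smlcStarAlgType R) (p : @unit_interval R) :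
  continuous (fun F : cont01 R B => F p).
Proof.
move=> F U /dist_nbhsE[e [e0 eU]].
suff : nbhs F [set G | U (G p)] by [].
apply/dist_nbhsE; exists e; split=> // G FG; apply: eU.
exact: le_lt_trans (dist_le_cont01 _ _ _) FG.
Qed.

Section pbam_change.
Context {A B : smlcStarAlgType R}.

(** Evaluation at p is a star homomorphism that increases neither the
    seminorms nor the metric, so it carries PBAMs to PBAMs. *)
Lemma pbam_eval (h : R -> A -> cont01 R B) (p : @unit_interval R) :
  is_pbam h -> is_pbam (fun t a => h t a p).
Proof.
have ev (u v : R -> cont01 R B) : asymp (pinfty_nbhs R) u v ->
    asymp (pinfty_nbhs R) (fun t => u t p) (fun t => v t p).
  move=> /asympP uv; apply/asympP => n e /(uv n) {}uv.
  near=> t; apply: le_lt_trans (seminorm_le_cont01 n (u t - v t) p) _.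
  by near: t.
move=> [hc hb hs hstar hscale hadd hmul]; split.
- move=> x; exact: cvg_comp _ _ (hc x) (@eval_cont01_continuous B p (h x.2 x.1)).
- move=> a n; have [M hM] := hb a n; exists M => t /hM; apply: le_trans.
  exact: seminorm_le_cont01.
- move=> e a e0; have [eta [P [eta0 P0 hP]]] := hs e a e0.
  exists eta, P; split=> // a' t aa' Pt.
  exact: le_lt_trans (dist_le_cont01 _ _ _) (hP a' t aa' Pt).
- by move=> a; exact: (ev _ _ (hstar a)).
- by move=> k a; exact: (ev _ _ (hscale k a)).
- by move=> a a'; exact: (ev _ _ (hadd a a')).
- by move=> a a'; exact: (ev _ _ (hmul a a')).
Unshelve. all: by end_near. Qed.

Lemma pbam_ext (f f' : R -> A -> B) :
  (forall t a, 0 <= t -> f t a = f' t a) -> is_pbam f -> is_pbam f'.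
Proof.
move=> ff' [fc fb fs fstar fscale fadd fmul].
have ev (u v u' v' : R -> B) : (forall t, 0 <= t -> u t = u' t) ->
    (forall t, 0 <= t -> v t = v' t) ->
    asymp (pinfty_nbhs R) u v -> asymp (pinfty_nbhs R) u' v'.
  move=> uu vv /asympP uv; apply/asympP => n e /(uv n) {}uv.
  near=> t.
  have t0 : 0 <= t by near: t; apply: nbhs_pinfty_ge; exact: num_real.
  by rewrite -uu// -vv//; near: t.
split.
- apply: (@subspace_eq_continuous _ _ _ (fun x : A * R => f x.2 x.1)) fc.
  by move=> [a t]; rewrite inE => -[_ /halflineP t0]; exact: ff'.
- by move=> a n; have [M fM] := fb a n; exists M => t t0; rewrite -ff'// fM.
- move=> e a e0; have [eta [P [eta0 P0 hP]]] := fs e a e0.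
  exists eta, P; split=> // a' t aa' Pt.
  by rewrite -!ff' ?(le_trans P0)// hP.
- by move=> a; apply: ev (fstar a) => t t0; rewrite ff'.
- by move=> k a; apply: ev (fscale k a) => t t0; rewrite !ff'.
- by move=> a a'; apply: ev (fadd a a') => t t0; rewrite !ff'.
- by move=> a a'; apply: ev (fmul a a') => t t0; rewrite !ff'.
Unshelve. all: by end_near. Qed.

End pbam_change.

(** * Iterated limits of the composite *)

(** C1: the radius xi of equicontinuity of the maps g_s at f_t(a) is uniform in
    t; only the time from which it works may depend on t. *)
Definition locally_equicontinuous (A B C : smlcStarAlgType R)
    (f : R -> A -> B) (g : R -> B -> C) : Prop :=
  forall (a : A) (nu : R), 0 < nu ->
    exists xi Q' : R, [/\ 0 < xi, 0 <= Q' &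
      forall t : R, Q' <= t -> exists S' : R, 0 <= S' /\
        forall (b : B) (s : R), S' <= s ->
          dist (f t a) b < xi -> dist (g s (f t a)) (g s b) < nu].

(** C3: likewise, the bound is uniform in t and only the time from which it
    holds may depend on t. *)
Definition eventually_bounded (A B C : smlcStarAlgType R)
    (f : R -> A -> B) (g : R -> B -> C) : Prop :=
  forall (a : A) (n : nat), exists Qn Mn : R, [/\ 0 <= Qn, 0 <= Mn &
    forall t : R, Qn <= t -> exists Sn : R, 0 <= Sn /\
      forall s : R, Sn <= s -> seminorm n (g s (f t a)) <= Mn].

Section composition.
Context {A B C : smlcStarAlgType R}.
Context (f : R -> A -> B) (g : R -> B -> C) (fP : is_pbam f) (gP : is_pbam g).

Definition two_time (a : A) (z : R * R) : C := g z.2 (f z.1 a).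

Section iterated_limits.
Context (C1 : locally_equicontinuous f g) (C3 : eventually_bounded f g).

(** C1 with a threshold on s that is locally uniform in t: near t0 the point
    f_t(a) lies within xi / 2 of f_t0(a), so that b within xi / 2 of f_t(a) is
    within xi of f_t0(a), and C1 at t0 compares both g_s(f_t(a)) and g_s(b) with
    g_s(f_t0(a)). *)
Lemma equicontinuous_iterated a nu : 0 < nu -> exists2 xi, 0 < xi &
  \forall z \near iterated_tail, forall b,
    dist (f z.1 a) b < xi -> dist (g z.2 (f z.1 a)) (g z.2 b) < nu.
Proof.
move=> nu0; have nu20 : 0 < nu / 2 by rewrite divr_gt0.
have [xi [Q [xi0 _ fgQ]]] := C1 a nu20.
have xi20 : 0 < xi / 2 by rewrite divr_gt0.
exists (xi / 2) => //; apply: near_iterated.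
near=> t0; have t00 : 0 < t0 by near: t0; apply: nbhs_pinfty_gt; exact: num_real.
have Qt0 : Q <= t0 by near: t0; apply: nbhs_pinfty_ge; exact: num_real.
have [S [_ fgS]] := fgQ t0 Qt0.
have t0f : \forall z \near tail_at t0, dist (f t0 a) (f z.1 a) < xi / 2.
  exact: near_tail_at_fst (cvg_dist (pbam_cvg fP t00) xi20).
have t0S := near_tail_at_ge t0 S.
near=> z => b zb.
have z0 : dist (f t0 a) (f z.1 a) < xi / 2 by near: z.
have Sz : S <= z.2 by near: z.
have := fgS (f z.1 a) z.2 Sz; have := fgS b z.2 Sz.
have := dist_triangle (f z.1 a) (f t0 a) b.
have := dist_triangle (g z.2 (f t0 a)) (g z.2 (f z.1 a)) (g z.2 b).
rewrite (dist_sym _ (g z.2 (f t0 a))) => h1 h2 h3 h4.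
have {}h3 := h3 ltac:(lra); have {}h4 := h4 ltac:(lra); lra.
Unshelve. all: by end_near. Qed.

Lemma bounded_iterated a : bounded_along iterated_tail (two_time a).
Proof.
move=> n; have [Q [M [_ _ fgM]]] := C3 a n.
exists (M + 1); apply: near_iterated.
near=> t0; have t00 : 0 < t0 by near: t0; apply: nbhs_pinfty_gt; exact: num_real.
have Qt0 : Q <= t0 by near: t0; apply: nbhs_pinfty_ge; exact: num_real.
have [S [_ fgS]] := fgM t0 Qt0.
have t0S := near_tail_at_ge t0 S.
have /asympP/(_ n 1 ltr01) t0a := pbam_asymp_at gP (pbam_cvg fP (a := a) t00).
near=> z; rewrite /two_time -[g _ _](subrK (g z.2 (f t0 a))) addrC.
rewrite (le_trans (seminormD _ _ _))// lerD//.
  by apply: fgS; near: z.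
by apply: ltW; near: z.
Unshelve. all: by end_near. Qed.

(** The laws are proved along an arbitrary filter over [iterated_tail], so that
    the point of A may move together with the two times. *)
Section along.
Context {T : Type} (F : set_system T) {FF : Filter F}.
Context (z : T -> R * R) (zE : z @ F --> iterated_tail).

(** The error made by f passes through g.  Nothing is asked of u but to be
    asymptotic to f_t(a), so u can be astar (f_t(a)), f_t(a) + f_t(a') and the
    like. *)
Lemma comp_follow a (u : T -> B) : asymp F (fun x => f (z x).1 a) u ->
  asymp F (fun x => two_time a (z x)) (fun x => g (z x).2 (u x)).
Proof.
move=> /asymp_distP fu; apply/asymp_distP => e e0.
have [xi xi0 Efg] := equicontinuous_iterated a e0.
have fg : \forall x \near F, forall b, dist (f (z x).1 a) b < xi ->
    dist (g (z x).2 (f (z x).1 a)) (g (z x).2 b) < e := zE Efg.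
have fux := fu _ xi0.
near=> x; apply: (near fg x) => //; by near: x.
Unshelve. all: by end_near. Qed.

Lemma iterated_along (u v : R * R -> C) : asymp iterated_tail u v ->
  asymp F (fun x => u (z x)) (fun x => v (z x)).
Proof. exact: asymp_comp. Qed.

Lemma comp_bounded a : bounded_along F (fun x => two_time a (z x)).
Proof. by move=> n; have [M /zE fgM] := bounded_iterated a n; exists M. Qed.

Lemma fst_along (u v : R -> B) : asymp (pinfty_nbhs R) u v ->
  asymp F (fun x => u (z x).1) (fun x => v (z x).1).
Proof.
apply: (asymp_comp (p := fun x => (z x).1)).
exact: cvg_comp _ _ zE iterated_tail_fst.
Qed.

(** Strong asymptotic continuity of f, pushed through g: the composite is
    locally uniform in a. *)
Lemma comp_near a (al : T -> A) : al @ F --> a ->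
  asymp F (fun x => two_time (al x) (z x)) (fun x => two_time a (z x)).
Proof.
move=> ala; apply: asymp_sym; apply: comp_follow; apply/asymp_distP => e e0.
have [eta [P [eta0 _ fP']]] := pbam_strongly_continuous fP a e0.
have aleta : \forall x \near F, dist a (al x) < eta := cvg_dist ala eta0.
have Poo : nbhs +oo [set t : R | P <= t] by apply: nbhs_pinfty_ge; exact: num_real.
have Pz : \forall x \near F, P <= (z x).1 := zE (iterated_tail_fst Poo).
by near=> x; apply: fP'; near: x.
Unshelve. all: by end_near. Qed.

(** The pattern of this and the next three lemmas: freeze the point of A, apply
    the law of g at f_t(a), then that of f inside g, and let the point move
    again. *)
Lemma comp_star_along (a : A) (al : T -> A) : al @ F --> a ->
  asymp F (fun x => astar (two_time (al x) (z x)))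
    (fun x => two_time (astar (al x)) (z x)).
Proof.
move=> ala; have sala : astar (al x) @[x --> F] --> astar a.
  exact: cvg_comp _ _ ala (@astar_continuous R A a).
apply: asymp_trans (asymp_star (comp_near ala)) _.
apply: asymp_trans _ (asymp_sym (comp_near sala)).
apply: asymp_trans _
  (asymp_sym (comp_follow (asymp_sym (fst_along (pbam_star fP a))))).
apply: (iterated_along (u := fun z => astar (two_time a z))
  (v := fun z => g z.2 (astar (f z.1 a)))).
apply: asymp_iterated => t0 t00.
exact: (pbam_star_at gP (pbam_cvg fP t00)).
Qed.

Lemma comp_scale_along (c : R[i]) (k : T -> R[i]) (a : A) (al : T -> A) :
  (forall e, 0 < e -> \forall x \near F, normc (k x - c) < e) -> al @ F --> a ->
  asymp F (fun x => k x *: two_time (al x) (z x))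
    (fun x => two_time (k x *: al x) (z x)).
Proof.
move=> kc ala; have kala : k x *: al x @[x --> F] --> c *: a.
  apply/cvg_seminormP; apply/asympP.
  apply: (asympZ (u' := fun=> a)) kc => //; first by apply/asympP/cvg_seminormP.
  by move=> n; exists (seminorm n a); near=> x.
apply: asymp_trans (asympZ (comp_near ala) (comp_bounded a) kc) _.
apply: asymp_trans _ (asymp_sym (comp_near kala)).
apply: asymp_trans _
  (asymp_sym (comp_follow (asymp_sym (fst_along (pbam_scale fP c a))))).
apply: (iterated_along (u := fun z => c *: two_time a z)
  (v := fun z => g z.2 (c *: (f z.1 a)))).
apply: asymp_iterated => t0 t00.
exact: (pbam_scale_at gP _ (pbam_cvg fP t00)).
Unshelve. all: by end_near. Qed.

Lemma comp_add_along (a a' : A) (al al' : T -> A) : al @ F --> a -> al' @ F --> a' ->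
  asymp F (fun x => two_time (al x) (z x) + two_time (al' x) (z x))
    (fun x => two_time (al x + al' x) (z x)).
Proof.
move=> ala ala'; have sala : al x + al' x @[x --> F] --> a + a'.
  exact: cvg_comp _ _ (cvg_pair ala ala') (@smlc_add_continuous R A (a, a')).
apply: asymp_trans (asympD (comp_near ala) (comp_near ala')) _.
apply: asymp_trans _ (asymp_sym (comp_near sala)).
apply: asymp_trans _
  (asymp_sym (comp_follow (asymp_sym (fst_along (pbam_add fP a a'))))).
apply: (iterated_along (u := fun z => two_time a z + two_time a' z)
  (v := fun z => g z.2 (f z.1 a + f z.1 a'))).
apply: asymp_iterated => t0 t00.
exact: (pbam_add_at gP (pbam_cvg fP t00) (pbam_cvg fP t00)).
Qed.

Lemma comp_mul_along (a a' : A) (al al' : T -> A) : al @ F --> a -> al' @ F --> a' ->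
  asymp F (fun x => amul (two_time (al x) (z x)) (two_time (al' x) (z x)))
    (fun x => two_time (amul (al x) (al' x)) (z x)).
Proof.
move=> ala ala'; have sala : amul (al x) (al' x) @[x --> F] --> amul a a'.
  exact: cvg_comp _ _ (cvg_pair ala ala') (@amul_continuous R A (a, a')).
apply: asymp_trans (asympM (comp_near ala) (comp_near ala')
  (comp_bounded a) (comp_bounded a')) _.
apply: asymp_trans _ (asymp_sym (comp_near sala)).
apply: asymp_trans _
  (asymp_sym (comp_follow (asymp_sym (fst_along (pbam_mul fP a a'))))).
apply: (iterated_along (u := fun z => amul (two_time a z) (two_time a' z))
  (v := fun z => g z.2 (amul (f z.1 a) (f z.1 a')))).
apply: asymp_iterated => t0 t00.
exact: (pbam_mul_at gP (pbam_cvg fP t00) (pbam_cvg fP t00)).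
Qed.

End along.

End iterated_limits.

(** * Uniform reparameterisations *)

(** The PBAM axioms for g_s(f_t(a)) as t grows, uniformly in s >= phi(t). *)
Record uniform_comp (phi : R -> R) : Prop := UniformComp {
  ucomp_bounded : forall a, bounded_along (tail_above phi) (two_time a);
  ucomp_strong : forall (e : R) a, 0 < e -> exists2 eta, 0 < eta &
    \forall z \near tail_above phi, forall a', dist a a' < eta ->
      dist (two_time a z) (two_time a' z) < e;
  ucomp_star : forall a, asymp (tail_above phi)
    (fun z => astar (two_time a z)) (two_time (astar a));
  ucomp_scale : forall (k : R[i]) a, asymp (tail_above phi)
    (fun z => k *: two_time a z) (two_time (k *: a));
  ucomp_add : forall a a', asymp (tail_above phi)
    (fun z => two_time a z + two_time a' z) (two_time (a + a'));
  ucomp_mul : forall a a', asymp (tail_above phi)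
    (fun z => amul (two_time a z) (two_time a' z)) (two_time (amul a a'))
}.

(** Everything that has to stay bounded (the first entry) or to tend to zero
    (the others) in terms of one point (k, a, a').  The second entry, at points
    with a = a', encodes strong asymptotic continuity. *)
Definition defects (x : (R[i])^o * A * A) (z : R * R) : seq C :=
  let k : R[i] := x.1.1 in let a := x.1.2 in let a' := x.2 in
  [:: two_time a z;
      two_time a z - two_time a' z;
      astar (two_time a z) - two_time (astar a) z;
      k *: two_time a z - two_time (k *: a) z;
      two_time a z + two_time a' z - two_time (a + a') z;
      amul (two_time a z) (two_time a' z) - two_time (amul a a') z].

Local Notation X := ((R[i])^o * A * A)%type.

Lemma exists_uniform : locally_equicontinuous f g ->
  eventually_bounded f g -> exists phi, is_reparam phi /\ uniform_comp phi.
Proof.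
move=> C1 C3.
have based : countably_based X.
  apply: countably_based_prod; last exact: countably_based_smlc.
  apply: countably_based_prod; last exact: countably_based_smlc.
  exact: countably_based_complex.
have [phi [phiP phiW]] :=
  transfer_to_reparam (K := (nat * nat * rat)%type) (fun c x z =>
  seminorm c.1.2 (nth 0 (defects x z) c.1.1) < ratr c.2) based.
exists phi; split=> //.
have FF (x : X) (G : set_system (R * R)) : Filter G ->
    Filter (filter_prod (nbhs x) G).
  by move=> FG; apply: filter_prod_filter.
(* Limits along [iterated_tail] become limits above phi. *)
have tr j (x : X) (u v : X * (R * R) -> C) :
    (forall y, nth 0 (defects y.1 y.2) j = u y - v y) ->
    asymp (filter_prod (nbhs x) iterated_tail) u v ->
    asymp (filter_prod (nbhs x) (tail_above phi)) u v.
  move=> juv /asympP uv; apply/asympP => n e e0.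
  have [q] := rat_in_itvoo e0; rewrite in_itv/= => /andP[q0 qe].
  have Dq : \forall y \near filter_prod (nbhs x) iterated_tail,
      seminorm n (nth 0 (defects y.1 y.2) j) < ratr q.
    by apply: filterS (uv n _ q0) => y; rewrite juv.
  have := phiW (j, n, q) x Dq; apply: filterS => y /= yq.
  by rewrite -juv (lt_trans yq).
(* Forget the uniformity in the point. *)
have sl (x : X) (u v : X * (R * R) -> C) :
    asymp (filter_prod (nbhs x) (tail_above phi)) u v ->
    asymp (tail_above phi) (fun z => u (x, z)) (fun z => v (x, z)).
  by apply: asymp_comp; move=> U; exact: near_slice.
have zE (x : X) : snd @ filter_prod (nbhs x) iterated_tail -->
    iterated_tail by exact: cvg_snd.
have xE (x : X) :
    y.1 @[y --> filter_prod (nbhs x) iterated_tail] --> x by exact: cvg_fst.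
have x1E (x : X) :
    y.1.1 @[y --> filter_prod (nbhs x) iterated_tail] --> x.1.
  have x1 : fst @ x --> x.1 by exact: cvg_fst.
  exact: (cvg_comp _ _ (xE x) x1).
have aE (x : X) :
    y.1.1.2 @[y --> filter_prod (nbhs x) iterated_tail] --> x.1.2.
  have x12 : snd @ x.1 --> x.1.2 by exact: cvg_snd.
  exact: (cvg_comp _ _ (x1E x) x12).
have aE' (x : X) :
    y.1.2 @[y --> filter_prod (nbhs x) iterated_tail] --> x.2.
  have x2 : snd @ x --> x.2 by exact: cvg_snd.
  exact: (cvg_comp _ _ (xE x) x2).
have kE (x : X) (e : R) : 0 < e ->
    \forall y \near filter_prod (nbhs x) iterated_tail,
    normc ((y.1.1.1 : R[i]) - x.1.1) < e.
  move=> e0; have x11 : fst @ x.1 --> x.1.1 by exact: cvg_fst.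
  apply: (cvg_comp _ _ (x1E x) x11 [set k | normc (k - x.1.1) < e]).
  by apply/nbhs_normcP; exists e.
split.
- move=> a n; pose x : X := (0, a, a).
  have [M uM] := asymp_bounded (comp_near C1 (zE x) (aE x))
    (comp_bounded C3 (zE x) a) n.
  have M1 : M < M + 1 by rewrite ltrDl.
  have [q] := rat_in_itvoo M1; rewrite in_itv/= => /andP[Mq _].
  have uq : \forall y \near filter_prod (nbhs x) iterated_tail,
      seminorm n (defects y.1 y.2)`_0 < ratr q.
    by apply: filterS uM => y /le_lt_trans; apply.
  exists (ratr q); have := phiW (0%N, n, q) x uq; move=> /near_slice.
  by apply: filterS => z /ltW.
- move=> e a e0; pose x : X := (0, a, a).
  have /asymp_distP/(_ e e0)[[U W] /= [xU phiWW] UW] : asymp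
      (filter_prod (nbhs x) (tail_above phi))
      (fun y => two_time y.1.1.2 y.2) (fun y => two_time y.1.2 y.2).
    apply: (tr 1%N) => //; apply: asymp_trans (comp_near C1 (zE x) (aE x)) _.
    exact: asymp_sym (comp_near C1 (zE x) (aE' x)).
  have xa : (0, a, a') @[a' --> a] --> x.
    exact: cvg_pair (@cvg_cst _ (0 : (R[i])^o, a) _ (nbhs a) _) (@cvg_id _ (nbhs a)).
  have /dist_nbhsE[eta [eta0 etaU]] := xa _ xU.
  exists eta => //; apply: filterS phiWW => z Wz a' aa'.
  by apply: (UW (0, a, a', z)); split=> //=; exact: etaU.
- move=> a; pose x : X := (0, a, a).
  apply: (sl x (fun y => astar (two_time y.1.1.2 y.2))
    (fun y => two_time (astar y.1.1.2) y.2)); apply: (tr 2%N) => //.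
  exact: (comp_star_along C1 (zE x) (aE x)).
- move=> k a; pose x : X := (k, a, a).
  apply: (sl x (fun y => (y.1.1.1 : R[i]) *: (two_time y.1.1.2 y.2))
    (fun y => two_time ((y.1.1.1 : R[i]) *: y.1.1.2) y.2)); apply: (tr 3%N) => //.
  exact: (comp_scale_along C1 C3 (zE x) (kE x) (aE x)).
- move=> a a'; pose x : X := (0, a, a').
  apply: (sl x (fun y => two_time y.1.1.2 y.2 + two_time y.1.2 y.2)
    (fun y => two_time (y.1.1.2 + y.1.2) y.2)); apply: (tr 4%N) => //.
  exact: (comp_add_along C1 (zE x) (aE x) (aE' x)).
- move=> a a'; pose x : X := (0, a, a').
  apply: (sl x (fun y => amul (two_time y.1.1.2 y.2) (two_time y.1.2 y.2))
    (fun y => two_time (amul y.1.1.2 y.1.2) y.2)); apply: (tr 5%N) => //.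
  exact: (comp_mul_along C1 C3 (zE x) (aE x) (aE' x)).
Qed.

(** * The homotopy *)

(** The path f_[0,T](a) is compact.  For s large, g_s is bounded on it by strong
    asymptotic continuity; the remaining s form a compact interval, on which joint
    continuity of g suffices. *)
Lemma comp_bounded_compact a n T : exists M, forall t s,
  0 <= t -> t <= T -> 0 <= s -> seminorm n (two_time a (t, s)) <= M.
Proof.
pose v t := f (Num.max 0 t) a.
have vc : continuous v.
  move=> t; have pc : (a, s) @[s --> t] --> (a, t).
    exact: cvg_pair (@cvg_cst A a _ (nbhs t) _) (@cvg_id _ (nbhs t)).
  have fc := @pbam_clamp_continuous _ _ _ fP (a, t).
  exact: (cvg_comp _ _ pc fc).
have /compact_near_coveringP cov := @segment_compact R 0 T.
(* P is both the threshold on s and the bound. *)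
have : \forall P \near +oo, [set` `[0, T]] `<=`
    (fun t => forall s, P <= s -> seminorm n (g s (v t)) <= P).
  apply: cov => t _; have [M [[U V] /= [tU [P [_ PV]]] UV]] :=
    pbam_bounded_at gP (vc t) n.
  exists (U, [set Q | P < Q /\ M <= Q]) => /=.
    split=> //; apply: filterI; first by apply: nbhs_pinfty_gt; exact: num_real.
    by apply: nbhs_pinfty_ge; exact: num_real.
  move=> [t' Q] /= [Ut' [PQ MQ]] s Qs; apply: le_trans MQ.
  by apply: (UV (t', s)); split=> //=; apply: PV; exact: lt_le_trans Qs.
move=> [P [_ PM]]; set Q := P + 1.
have {}PM t s : 0 <= t -> t <= T -> Q <= s -> seminorm n (g s (v t)) <= Q.
  move=> t0 tT; apply: PM; first by rewrite ltrDl.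
  by rewrite /= in_itv/= t0.
pose w (z : R * R) := seminorm n (g (Num.max 0 z.2) (v z.1)).
have wc : continuous w.
  move=> z; have pc : (v y.1, y.2) @[y --> z] --> (v z.1, z.2).
    have fstc : fst @ z --> z.1 by exact: cvg_fst.
    exact: cvg_pair (cvg_comp _ _ fstc (vc z.1)) cvg_snd.
  have gc := cvg_comp _ _ pc (@pbam_clamp_continuous _ _ _ gP (v z.1, z.2)).
  exact: (cvg_comp _ _ gc (@seminorm_continuous _ _ n _)).
have /compact_bounded[M [_ /(_ (M + 1))]] :
    compact (w @` (`[0, T] `*` `[0, Q])).
  apply: continuous_compact; first exact: continuous_subspaceT.
  by apply: compact_setX; exact: segment_compact.
rewrite ltrDl ltr01 => /(_ isT) wM; exists (Num.max Q (M + 1)) => t s t0 tT s0.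
have -> : two_time a (t, s) = g s (v t) by rewrite /two_time/= /v max_r.
rewrite le_max; case: (lerP Q s) => [Qs|sQ]; first by rewrite PM.
apply/orP; right; apply: le_trans (ler_norm _) _; apply: wM.
exists (t, s) => /=; last by rewrite /w/= max_r.
by split; rewrite /= in_itv/= ?t0 ?s0//= ltW.
Qed.

Section homotopy.
Context (phi theta : R -> R) (phiP : is_reparam phi) (thetaP : is_reparam theta).
Context (phi_theta : forall t, 0 <= t -> phi t <= theta t).
Context (phiU : uniform_comp phi).

Definition segment_time (p : @unit_interval R) (t : R) : R :=
  \val p * phi t + (1 - \val p) * theta t.

Lemma segment_time_ge p t : 0 <= t -> phi t <= segment_time p t.
Proof.
move=> t0; have /andP[p0 p1] := val_unit p; have := phi_theta t0.
rewrite /segment_time; nra.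
Qed.

Lemma segment_time_ge0 p t : 0 <= t -> 0 <= segment_time p t.
Proof.
move=> t0; have [_ _ phi0] := phiP.
exact: le_trans (phi0 t t0) (segment_time_ge p t0).
Qed.

(** Both times are clamped, which makes this continuous on the whole of
    A * R * [0, 1]. *)
Definition homotopy_fun (x : A * R) (p : @unit_interval R) : C :=
  g (Num.max 0 (segment_time p (Num.max 0 x.2))) (f (Num.max 0 x.2) x.1).

Lemma homotopy_funE a t p : 0 <= t ->
  homotopy_fun (a, t) p = two_time a (t, segment_time p t).
Proof. by move=> t0; rewrite /homotopy_fun/= max_r// max_r// segment_time_ge0. Qed.

Lemma homotopy_fun_continuous :
  continuous (fun y : (A * R) * @unit_interval R => homotopy_fun y.1 y.2).
Proof.
move=> y.
have tc : z.1.2 @[z --> y] --> y.1.2 by exact: cvg_comp _ _ cvg_fst cvg_snd.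
have fc : f (Num.max 0 z.1.2) z.1.1 @[z --> y] --> f (Num.max 0 y.1.2) y.1.1.
  have yc : z.1 @[z --> y] --> y.1 by exact: cvg_fst.
  exact: (cvg_comp _ _ yc (@pbam_clamp_continuous _ _ _ fP y.1)).
have phic := cvg_comp _ _ tc (@reparam_clamp_continuous phi phiP y.1.2).
have thetac := cvg_comp _ _ tc (@reparam_clamp_continuous theta thetaP y.1.2).
have pc : \val z.2 @[z --> y] --> (\val y.2 : R).
  have yc : z.2 @[z --> y] --> y.2 by exact: cvg_snd.
  exact: (cvg_comp _ _ yc (@initial_continuous _ _ _ y.2)).
have sc : segment_time z.2 (Num.max 0 z.1.2) @[z --> y] -->
    segment_time y.2 (Num.max 0 y.1.2).
  apply: cvgD; first exact: cvgM.
  by apply: cvgM => //; apply: cvgB => //; exact: cvg_cst.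
have gc := @pbam_clamp_continuous _ _ _ gP
  (f (Num.max 0 y.1.2) y.1.1, segment_time y.2 (Num.max 0 y.1.2)).
exact: (cvg_comp _ _ (cvg_pair fc sc) gc).
Qed.

Lemma homotopy_fun_continuous_at x : continuous (homotopy_fun x).
Proof.
move=> p; have pc : (x, q) @[q --> p] --> (x, p).
  exact: cvg_pair (@cvg_cst _ x _ (nbhs p) _) (@cvg_id _ (nbhs p)).
exact: (cvg_comp _ _ pc (@homotopy_fun_continuous (x, p))).
Qed.

Definition homotopy (t : R) (a : A) : cont01 R C :=
  mk_cont01 (@homotopy_fun_continuous_at (a, t)).

Lemma homotopyE t a p : 0 <= t -> homotopy t a p = two_time a (t, segment_time p t).
Proof. exact: homotopy_funE. Qed.

Lemma near_segment_time (W : set (R * R)) : (\forall z \near tail_above phi, W z) ->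
  \forall t \near +oo, forall p, W (t, segment_time p t).
Proof.
move=> phiW; near=> t => p.
have tW : forall s, phi t <= s -> W (t, s) by near: t; exact: phiW.
by apply/tW/segment_time_ge; near: t; apply: nbhs_pinfty_ge; exact: num_real.
Unshelve. all: by end_near. Qed.

(** Uniformity in s above phi is uniformity in p, and the supremum over p is
    then at most e / 2. *)
Lemma asymp_cont01 (u v : R * R -> C) (U V : R -> cont01 R C) :
  asymp (tail_above phi) u v ->
  (forall t p, 0 <= t -> U t p = u (t, segment_time p t)) ->
  (forall t p, 0 <= t -> V t p = v (t, segment_time p t)) ->
  asymp (pinfty_nbhs R) U V.
Proof.
move=> /asympP uv Uu Vv; apply/asympP => n e e0.
have e20 : 0 < e / 2 by rewrite divr_gt0.
have {}uv := near_segment_time (uv n _ e20).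
near=> t; have t0 : 0 <= t by near: t; apply: nbhs_pinfty_ge; exact: num_real.
apply: (@le_lt_trans _ _ (e / 2)); last lra.
apply: cont01_seminorm_le => p; rewrite -[leLHS]/(seminorm n (U t p - V t p)).
by rewrite Uu// Vv// ltW//; apply: (near uv t).
Unshelve. all: by end_near. Qed.

Lemma homotopy_pbam : is_pbam homotopy.
Proof.
split.
- apply: continuous_subspaceT; apply: curry_cont01_continuous.
  exact: homotopy_fun_continuous.
- move=> a n; have [M /near_segment_time[T [_ TM]]] := ucomp_bounded phiU a n.
  have [N TN] := comp_bounded_compact a n T.
  exists (Num.max M N) => t t0; apply: cont01_seminorm_le => p.
  rewrite homotopyE// le_max; case: (lerP t T) => [tT|Tt].
    by rewrite TN ?orbT// segment_time_ge0.
  by rewrite TM.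
- move=> e a e0; have e20 : 0 < e / 2 by rewrite divr_gt0.
  have [eta eta0 /near_segment_time[T [_ TE]]] := ucomp_strong phiU a e20.
  exists eta, (Num.max 0 (T + 1)); split=> // [|a' t aa'].
    by rewrite le_max lexx.
  rewrite ge_max => /andP[t0 Tt]; apply: (@le_lt_trans _ _ (e / 2)); last lra.
  apply: cont01_dist_le => p; rewrite !homotopyE// ltW// TE//; lra.
- move=> a; apply: (asymp_cont01 (ucomp_star phiU a)) => t p t0.
    by rewrite -homotopyE.
  by rewrite -homotopyE.
- move=> k a; apply: (asymp_cont01 (ucomp_scale phiU k a)) => t p t0.
    by rewrite -homotopyE.
  by rewrite -homotopyE.
- move=> a a'; apply: (asymp_cont01 (ucomp_add phiU a a')) => t p t0.
    by rewrite -!homotopyE.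
  by rewrite -homotopyE.
- move=> a a'; apply: (asymp_cont01 (ucomp_mul phiU a a')) => t p t0.
    by rewrite -!homotopyE.
  by rewrite -homotopyE.
Qed.

Lemma homotopy0 t a : 0 <= t -> homotopy t a unit0 = pbam_comp g theta f t a.
Proof.
by move=> t0; rewrite homotopyE// /segment_time val_unit0 mul0r add0r subr0 mul1r.
Qed.

Lemma homotopy1 t a : 0 <= t -> homotopy t a unit1 = pbam_comp g phi f t a.
Proof.
by move=> t0; rewrite homotopyE// /segment_time val_unit1 subrr mul0r addr0 mul1r.
Qed.

End homotopy.

(** Each composite is obtained from a homotopy by evaluation at p = 0; for the
    composite along phi itself, take theta = phi. *)
Lemma uniform_valid phi : is_reparam phi -> uniform_comp phi ->
  valid_reparam f g phi.
Proof.
move=> phiP phiU.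
have compP theta (thetaP : is_reparam theta)
    (pt : forall t, 0 <= t -> phi t <= theta t) : is_pbam (pbam_comp g theta f).
  apply: pbam_ext (pbam_eval unit0 (homotopy_pbam phiP thetaP pt phiU)).
  by move=> t a; exact: homotopy0.
split; first exact: compP.
move=> theta thetaP pt; split; first exact: compP.
exists (homotopy phiP thetaP); split; first by move=> t a p; exact: homotopyE.
split; [exact: compP|exact: compP|exact: homotopy_pbam|].
by move=> t a t0; split; [exact: homotopy0|exact: homotopy1].
Qed.

End composition.

End pbam_composition.

Theorem theorem7p4 (R : realType) (A B C : smlcStarAlgType R)
    (f : R -> A -> B) (g : R -> B -> C)
    (f_pbam : is_pbam f) (g_pbam : is_pbam g)
    (C1 : forall (a : A) (nu : R), 0 < nu ->
      exists xi Q' : R, [/\ 0 < xi, 0 <= Q' &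
        forall t : R, Q' <= t -> exists S' : R, 0 <= S' /\
          forall (b : B) (s : R), S' <= s ->
            dist (f t a) b < xi -> dist (g s (f t a)) (g s b) < nu])
    (C3 : forall (a : A) (n : nat),
      exists Qn Mn : R, [/\ 0 <= Qn, 0 <= Mn &
        forall t : R, Qn <= t -> exists Sn : R, 0 <= Sn /\
          forall s : R, Sn <= s -> seminorm n (g s (f t a)) <= Mn]) :
  exists phi : R -> R, is_reparam phi /\ valid_reparam f g phi.
Proof.
have [phi [phiP phiU]] := exists_uniform f_pbam g_pbam C1 C3.
by exists phi; split=> //; exact: uniform_valid.
Qed.
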